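(* Let $n\ge2$ and let $X\subset\mathbb{R}^n$ be Borel and non-concentrated with $\dim X>0$. Then for any $0<s<\dim X$ there exist a (finite) collection of affine subspaces $V_1,\dots,V_m\subset\mathbb{R}^n$ and $s$-Frostman measures $\mu_i$ supported on $X\cap V_i$, $i=1,\dots,m$, such that: (i) each $\mu_i$ is irreducible in $V_i$ and $\mu_i(X)>0$; (ii) the supports $\operatorname{supp}\mu_i$ are pairwise disjoint; (iii) for any affine subspaces $F_1,\dots,F_r\subset\mathbb{R}^n$ such that $\bigcup_{i=1}^m V_i\subset\bigcup_{j=1}^r F_j$, we have $\sum_{j=1}^r\dim F_j\ge n$.
   Context: $\dim$ of a set is Hausdorff dimension; $\dim$ of an affine subspace is its usual dimension. A Borel set $X\subset\mathbb{R}^n$ is non-concentrated (NC) if for any $r\ge 1$ and any affine subspaces $F_1,\dots,F_r\subset\mathbb{R}^n$ with $\sum_{i=1}^r\dim F_i\le n-1$ one has $\dim\big(X\setminus\bigcup_{i=1}^r F_i\big)=\dim X$. Measures are finite Borel measures. A measure $\mu$ is $s$-Frostman if there is $C>0$ with $\mu(B(x,r))\le Cr^s$ for all $x$ and all $r>0$. A measure $\mu$ supported on an affine subspace $V$ is irreducible in $V$ if $\mu(V')=0$ for every proper affine subspace $V'\subset V$. *)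

(* Defs.v *)
From HB Require Import structures.
From mathcomp Require Import all_boot all_order all_algebra.
From mathcomp Require Import all_classical all_reals all_analysis.

Set Implicit Arguments.
Unset Strict Implicit.
Unset Printing Implicit Defensive.
Import Order.TTheory GRing.Theory Num.Theory.
Import numFieldNormedType.Exports.

Local Open Scope classical_set_scope.
Local Open Scope ring_scope.

(* R^n is 'rV[R]_n. The library norm on matrices is the sup norm; it induces
   the usual topology, so open sets and Borel sets are taken from the library,
   whereas balls and diameters use the Euclidean distance below. *)
Definition opens (R : realType) (n : nat) : set (set 'rV[R]_n) :=
  [set U | open U].
Arguments opens : clear implicits.

Notation borelRn R n := (g_sigma_algebraType (opens R n)).

Definition edist (R : realType) (n : nat) (x y : 'rV[R]_n) : R :=
  Num.sqrt (\sum_(i < n) (x 0 i - y 0 i) ^+ 2).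

Definition eball (R : realType) (n : nat) (x : 'rV[R]_n) (r : R) :
    set 'rV[R]_n :=
  [set y | edist x y <= r].

Section hausdorff.
Local Open Scope ereal_scope.
Variables (R : realType) (n : nat).
Implicit Types (U A : set 'rV[R]_n) (s delta : R).

(* The supremum of the empty set is -oo, so diam set0 = -oo. *)
Definition diam U : \bar R :=
  ereal_sup [set d | exists x y, [/\ U x, U y & d = (edist x y)%:E]].

(* For s = 0 this is 1 on nonempty sets (0 `^ 0 = 1) and 0 on the empty set. *)
Definition diam_pow s U : \bar R :=
  if U == set0 then 0 else diam U `^ s.

Definition hausdorff_content s delta A : \bar R :=
  ereal_inf [set c | exists U : nat -> set 'rV[R]_n,
    [/\ A `<=` \bigcup_i U i,
        forall i, diam (U i) <= delta%:E
      & c = \sum_(0 <= i <oo) diam_pow s (U i)]].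

Definition hausdorff_measure s A : \bar R :=
  ereal_sup [set hausdorff_content s delta A | delta in [set d : R | (0 < d)%R]].

Definition hausdorff_dim A : \bar R :=
  ereal_inf [set s%:E | s in [set s : R | (0 <= s)%R /\
                                          hausdorff_measure s A = 0]].

End hausdorff.

(* The nonempty affine subspace apoint + adir; distinct records may denote the
   same subspace. *)
Record affine (R : realType) (n : nat) := Affine {
  apoint : 'rV[R]_n;
  adir : {vspace 'rV[R]_n}
}.

Definition aset (R : realType) (n : nat) (V : affine R n) : set 'rV[R]_n :=
  [set x | x - apoint V \in adir V].

Definition adim (R : realType) (n : nat) (V : affine R n) : nat :=
  \dim (adir V).

Definition non_concentrated (R : realType) (n : nat) (X : set 'rV[R]_n) : Prop :=
  forall (r : nat) (F : 'I_r -> affine R n), (1 <= r)%N ->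
    (\sum_(i < r) adim (F i) <= n - 1)%N ->
    hausdorff_dim (X `\` \bigcup_i aset (F i)) = hausdorff_dim X.

Section measures.
Local Open Scope ereal_scope.
Variables (R : realType) (n : nat).
Implicit Type mu : {finite_measure set (borelRn R n) -> \bar R}.

Definition frostman (s : R) mu : Prop :=
  exists2 C : R, (0 < C)%R &
    forall (x : 'rV[R]_n) (r : R), (0 < r)%R ->
      mu (eball x r) <= (C * r `^ s)%:E.

Definition supp mu : set 'rV[R]_n :=
  [set x | forall U : set 'rV[R]_n, open U -> U x -> 0 < mu U].

(* For Borel A this implies mu (~` A) = 0, and is equivalent to it when A is
   closed. *)
Definition supported_on mu (A : set 'rV[R]_n) : Prop := supp mu `<=` A.

Definition irreducible_in mu (V : affine R n) : Prop :=
  supported_on mu (aset V) /\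
  forall V' : affine R n, aset V' `<` aset V -> mu (aset V') = 0.

End measures.

(* Main.v *)
(* Frostman's lemma is proved on the binary tree. Interleaving binary digits
   maps the Cantor space onto a cube, matching cylinders of depth k with boxes
   of diameter about 2^(-k/n), so that Hausdorff content becomes the cheapest
   covering by cylinders of weight q^k, q = 2^(-s/n). This content is continuous
   along increasing sequences of sets, hence a Borel (Souslin) set of positive
   content contains a compact set Y of positive content. If M(t) is the content
   of the part of Y lexicographically below t, the increment of M over a
   cylinder is at most its weight, by subadditivity: M is the distribution
   function of a Frostman measure carried by Y.

   A Frostman measure restricted to an affine subspace V of minimal dimension
   among those of positive measure is irreducible in V. By non-concentration,
   for every family F of total dimension at most n-1 there is such a V outside
   the union of F. A covering of V that is refined by F contains V in one
   member, so it is refined by F with V joined to one of its blocks, or added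
   as a new block; both raise the total dimension, so finitely many V suffice.
   Restricting to small balls around distinct points makes supports disjoint. *)

Require Import Defs.
From HB Require Import structures.
From mathcomp Require Import all_boot all_order all_algebra.
From mathcomp Require Import all_classical all_reals all_analysis.
From mathcomp Require Import ring lra.
From Stdlib Require List.

Set Implicit Arguments.
Unset Strict Implicit.
Unset Printing Implicit Defensive.
Import Order.TTheory GRing.Theory Num.Theory.
Import numFieldNormedType.Exports.

Local Open Scope classical_set_scope.
Local Open Scope ring_scope.

(** * Covering content on the binary tree *)

Definition cyl (w : seq bool) : set (nat -> bool) :=
  [set a | mkseq a (size w) = w].

Lemma cyl_mkseq a k : cyl (mkseq a k) a.
Proof. by rewrite /cyl /= size_mkseq. Qed.

Lemma cyl_rcons w b a : cyl (rcons w b) a <-> cyl w a /\ a (size w) = b.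
Proof.
rewrite /cyl /= size_rcons mkseqS; split=> [/eqP|[-> ->]//].
by rewrite eqseq_rcons => /andP[/eqP -> /eqP ->].
Qed.

Section TreeContent.
Variables (R : realType) (q : R) (q_gt0 : 0 < q).
Implicit Types (w v : seq bool) (g : seq bool -> R) (A B : set (nat -> bool)).

Definition superadditive_below w g : Prop :=
  forall v, prefix w v -> g (rcons v false) + g (rcons v true) <= g v.

(* A covering of A by cylinders [w_i], of cost the sum of the q ^ size w_i, is
   encoded by the function sending v to the cost of the w_i extending v. *)
Definition covering w A g : Prop :=
  [/\ forall v, 0 <= g v,
      superadditive_below w g
    & forall a, A a -> cyl w a ->
        exists2 k, (size w <= k)%N & q ^+ k <= g (mkseq a k)].

Definition content w A : R := inf [set g w | g in covering w A].

Definition single w v : R := if v == w then q ^+ size w else 0.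

Lemma single_ge0 w v : 0 <= single w v.
Proof. by rewrite /single; case: ifP => // _; rewrite exprn_ge0 // ltW. Qed.

Lemma covering_single w A : covering w A (single w).
Proof.
split=> [v|v wv|a _ wa]; first exact: single_ge0.
- have wvb b : rcons v b == w = false.
    apply/eqP => e; have := size_prefix wv.
    by rewrite -e size_rcons ltnn.
  by rewrite {1 2}/single !wvb addr0 single_ge0.
- by exists (size w) => //; rewrite wa /single eqxx.
Qed.

Lemma content_has_inf w A : has_inf [set g w | g in covering w A].
Proof.
split; first by exists (single w w), (single w) => //; exact: covering_single.
by exists 0 => _ [g [g0 _ _] <-].
Qed.

Lemma content_ge0 w A : 0 <= content w A.
Proof.
apply: lb_le_inf; first by case: (content_has_inf w A).
by move=> _ [g [g0 _ _] <-].
Qed.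

Lemma content_le w A g : covering w A g -> content w A <= g w.
Proof.
by move=> c; have [_ lb] := content_has_inf w A; apply: (ge_inf lb); exists g.
Qed.

Lemma content_ltP w A c :
  content w A < c -> exists2 g, covering w A g & g w < c.
Proof.
move=> lt_c; have e0 : 0 < c - content w A by rewrite subr_gt0.
have [_ [g cg <-]] := inf_adherent e0 (content_has_inf w A).
by rewrite -/(content w A) addrC subrK => gc; exists g.
Qed.

Lemma content_le_pow w A : content w A <= q ^+ size w.
Proof.
by apply: le_trans (content_le (covering_single w A)) _; rewrite /single eqxx.
Qed.

Lemma covering_sub w A B g :
  (A `&` cyl w `<=` B) -> covering w B g -> covering w A g.
Proof.
by move=> AB [g0 sg Bg]; split=> // a Aa wa; apply: Bg => //; apply: AB.
Qed.

Lemma content_mono w A B : A `&` cyl w `<=` B -> content w A <= content w B.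
Proof.
move=> AB; apply: lb_le_inf; first by case: (content_has_inf w B).
by move=> _ [g cg <-]; apply: content_le; apply: covering_sub cg.
Qed.

Lemma content_set0 w A : A `&` cyl w `<=` set0 -> content w A = 0.
Proof.
move=> A0; apply/eqP; rewrite eq_le content_ge0 andbT.
apply: (@content_le _ _ (fun=> 0)); split=> [//|v _|a Aa wa].
  by rewrite addr0.
by have := A0 a (conj Aa wa).
Qed.

Lemma covering_rcons w b A g : covering w A g -> g w < q ^+ size w ->
  covering (rcons w b) A g.
Proof.
move=> [g0 sg Ag] gw; split=> // [v|a Aa].
  by move=> /(prefix_trans (prefix_rcons w b)); exact: sg.
move=> /cyl_rcons[wa _]; have [k] := Ag a Aa wa.
rewrite leq_eqVlt => /predU1P[<-|wk] qg; last by exists k; rewrite ?size_rcons.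
by move: qg; rewrite wa leNgt gw.
Qed.

Lemma content_split w A : content w A < q ^+ size w ->
  content (rcons w false) A + content (rcons w true) A <= content w A.
Proof.
move=> lt_w; rewrite leNgt; apply/negP => lt.
have : content w A < Num.min (q ^+ size w)
  (content (rcons w false) A + content (rcons w true) A).
  by rewrite lt_min lt_w lt.
move=> /content_ltP[g cg]; rewrite lt_min => /andP[gq].
apply/negP; rewrite -leNgt; move: gq.
move=> gq; have [_ sg _] := cg; apply: le_trans (sg w (prefix_refl w)).
by apply: lerD; apply: content_le; exact: covering_rcons.
Qed.

Lemma content_cyl A w : content [::] (A `&` cyl w) <= q ^+ size w.
Proof.
pose g v := if prefix v w then q ^+ size w else 0.
have g0 v : 0 <= g v by rewrite /g; case: ifP => // _; rewrite exprn_ge0 // ltW.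
suff cg : covering [::] (A `&` cyl w) g by apply: le_trans (content_le cg) _; rewrite /g prefix0s.
split=> // [v _|a [_ wa] _]; last first.
  by exists (size w) => //; rewrite wa /g prefix_refl.
case vw : (prefix v w); last first.
  have nb b : prefix (rcons v b) w = false.
    apply/negP => /(prefix_trans (prefix_rcons v b)); rewrite vw.
    by [].
  by rewrite {1 2}/g !nb addr0.
have [|ff] := boolP (prefix (rcons v false) w); last first.
  rewrite {1}/g (negbTE ff) add0r /g vw; case: ifP => // _.
  by rewrite exprn_ge0 // ltW.
move=> pf; have pt : prefix (rcons v true) w = false.
  move: pf; rewrite !prefixE !size_rcons => /eqP -> ; apply/eqP => /eqP.
  by rewrite eqseq_rcons andbF.
by rewrite /g pf pt vw addr0.
Qed.

Lemma contentU w A B : content w (A `|` B) <= content w A + content w B.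
Proof.
rewrite leNgt; apply/negP => lt.
pose e := (content w (A `|` B) - (content w A + content w B)) / 2.
have e0 : 0 < e by rewrite divr_gt0 // subr_gt0.
have [g [g0 sg Ag] ltg] : exists2 g, covering w A g & g w < content w A + e.
  by apply: content_ltP; rewrite ltrDl.
have [h [h0 sh Bh] lth] : exists2 g, covering w B g & g w < content w B + e.
  by apply: content_ltP; rewrite ltrDl.
suff : content w (A `|` B) <= g w + h w.
  by apply/negP; rewrite -ltNge; move: ltg lth; rewrite /e; lra.
apply: (@content_le _ _ (fun v => g v + h v)); split=> [v|v wv|a [Aa|Ba] wa].
- by rewrite addr_ge0.
- by rewrite addrACA lerD ?sg ?sh.
- have [k wk qk] := Ag a Aa wa; exists k => //.
  by rewrite (le_trans qk) // lerDl.
- have [k wk qk] := Bh a Ba wa; exists k => //.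
  by rewrite (le_trans qk) // lerDr.
Qed.

Lemma superadditive_le g v u : (forall v, 0 <= g v) ->
  superadditive_below v g -> g (v ++ u) <= g v.
Proof.
move=> g0 sg; elim/last_ind: u => [|u b IH]; first by rewrite cats0.
rewrite -rcons_cat; apply: le_trans IH; apply: le_trans (sg (v ++ u) _).
  by case: b; rewrite ?lerDl ?lerDr.
exact: prefix_prefix.
Qed.

Lemma content_bigcup0 (A : nat -> set (nat -> bool)) :
  (forall i, content [::] (A i) = 0) -> content [::] (\bigcup_i A i) = 0.
Proof.
move=> A0; apply/eqP; rewrite eq_le content_ge0 andbT; apply/ler_addgt0Pl.
move=> e e0; rewrite addr0.
have /choice[g gP] i : exists g, covering [::] (A i) g /\
    g [::] < e / 2 ^+ i.+1.
  have [|g cg ltg] := @content_ltP [::] (A i) (e / 2 ^+ i.+1).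
    by rewrite A0 divr_gt0 // exprn_gt0.
  by exists g.
have g0 i v : 0 <= g i v by have [[]] := gP i.
have sg i : superadditive_below [::] (g i) by have [[]] := gP i.
pose S N v := \sum_(i < N) g i v.
have Smono N N' v : (N <= N')%N -> S N v <= S N' v.
  move=> /subnKC <-; elim: (N' - N)%N => [|k IH]; first by rewrite addn0.
  by rewrite addnS /S big_ord_recr /= (le_trans IH) // lerDl.
have Sle N v : S N v <= e.
  have -> : e = e * 1 by rewrite mulr1.
  apply: (@le_trans _ _ (e * (1 - (2 ^+ N)^-1))); last first.
    by rewrite ler_pM2l // lerBlDr lerDl invr_ge0 exprn_ge0.
  rewrite /S; elim: N => [|N IH]; first by rewrite big_ord0 expr0 invr1 subrr mulr0.
  rewrite big_ord_recr /=; apply: (@le_trans _ _ (e * (1 - (2 ^+ N)^-1) + e / 2 ^+ N.+1)).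
    apply: lerD => //; have [_ /ltW] := gP N; apply: le_trans.
    exact: (@superadditive_le (g N) [::] v).
  rewrite -mulrDr ler_pM2l // exprS invfM -addrA lerD2l.
  set x := (_ ^+ N)^-1; lra.
pose G v := sup (range (S ^~ v)).
have ubS v : has_ubound (range (S ^~ v)) by exists e => _ [N _ <-].
have SG N v : S N v <= G v by apply: ub_le_sup => //; exists N.
have Gle v x : (forall N, S N v <= x) -> G v <= x.
  by move=> Sx; apply: ge_sup => [|_ [N _ <-]//]; exists (S 0%N v), 0%N.
suff cG : covering [::] (\bigcup_i A i) G.
  by apply: le_trans (content_le cG) _; apply: Gle => N.
split=> [v|v pv|a [i _ Aia] wa].
- by apply: le_trans (SG 0%N v); rewrite /S big_ord0.
- rewrite -lerBrDr; apply: (Gle) => N; rewrite lerBrDl -lerBrDr; apply: Gle => N'.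
  rewrite lerBrDr; apply: le_trans (SG (maxn N N') v).
  apply: (@le_trans _ _ (S (maxn N N') (rcons v false) + S (maxn N N') (rcons v true))).
    by rewrite addrC lerD // Smono // ?leq_maxl ?leq_maxr.
  by rewrite /S -big_split /=; apply: ler_sum => j _; exact: sg.
- have [[_ _ Ag] _] := gP i; have [k k0 qk] := Ag a Aia wa; exists k => //.
  apply: le_trans (SG i.+1 _); apply: (le_trans qk).
  by rewrite /S big_ord_recr /= lerDr sumr_ge0.
Qed.

End TreeContent.
Section ContentContinuity.
Variables (R : realType) (q : R) (q_gt0 : 0 < q).
Implicit Types (w v : seq bool) (A B : set (nat -> bool)).

Local Notation content := (content q).
Local Notation covering := (covering q).

Definition first_stop (T : pred (seq bool)) v :=
  find (fun k => T (take k v)) (iota 0 (size v).+1).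

Lemma first_stopE (T : pred (seq bool)) v k : (k <= size v)%N -> T (take k v) ->
  (forall j, (j < k)%N -> ~~ T (take j v)) -> first_stop T v = k.
Proof.
move=> kv Tk Tj; rewrite /first_stop -(subnKC (leqW kv)) iotaD find_cat.
rewrite ifF; last first.
  apply/hasP => -[j]; rewrite mem_iota add0n => /= jk.
  by apply/negP; exact: Tj.
by rewrite size_iota add0n subSn //= Tk addn0.
Qed.

Lemma first_stopP (T : pred (seq bool)) v :
  (exists2 k, (k <= size v)%N /\ T (take k v) &
     forall j, (j < k)%N -> ~~ T (take j v)) \/
  ((size v < first_stop T v)%N /\ forall j, (j <= size v)%N -> ~~ T (take j v)).
Proof.
have [h|nh] := boolP (has (fun k => T (take k v)) (iota 0 (size v).+1)).
  left; have /hasP[k] := h; rewrite mem_iota add0n => /= kv Tk.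
  have ex : exists k, T (take k v) by exists k.
  exists (ex_minn ex); case: ex_minnP => m Tm mmin.
    by split=> //; rewrite (leq_trans (mmin k Tk)) // -ltnS.
  by move=> j jm; apply/negP => /mmin; rewrite leqNgt jm.
right; split; first by rewrite /first_stop hasNfind // size_iota.
move=> j jv; apply/negP => Tj; move/hasP: nh; apply.
by exists j => //; rewrite mem_iota add0n.
Qed.

Lemma content_paste (T : pred (seq bool)) (h : seq bool -> seq bool -> R)
    (G : seq bool -> R) A :
  (forall v, 0 <= G v) ->
  (forall v, ~~ T v -> G (rcons v false) + G (rcons v true) <= G v) ->
  (forall w, T w -> covering w A (h w) /\ h w w <= G w) ->
  (forall a, A a -> exists k, T (mkseq a k)) ->
  content [::] A <= G [::].
Proof.
move=> G0 sG hP AT.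
pose P v := if (first_stop T v <= size v)%N then h (take (first_stop T v) v) v
            else G v.
have PE k v : (k <= size v)%N -> T (take k v) ->
    (forall j, (j < k)%N -> ~~ T (take j v)) -> P v = h (take k v) v.
  by move=> kv Tk Tj; rewrite /P (first_stopE kv Tk Tj) kv.
have PG v : (forall j, (j < size v)%N -> ~~ T (take j v)) -> P v <= G v.
  move=> Tj; have [Tv|nTv] := boolP (T v).
    have := @PE (size v) v (leqnn _); rewrite take_size => -> //.
    by case: (hP v Tv).
  case: (first_stopP T v) => [[k [kv Tk] _]|[lt _]]; last by rewrite /P leqNgt lt.
  move: kv Tk; rewrite leq_eqVlt => /predU1P[->|kv]; last by rewrite (negbTE (Tj _ _)).
  by rewrite take_size (negbTE nTv).
have take_rc k v b : (k <= size v)%N -> take k (rcons v b) = take k v.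
  by move=> kv; rewrite -cats1 takel_cat.
suff cP : covering [::] A P by apply: le_trans (content_le q_gt0 cP) (PG _ _).
split=> [v|v _|a Aa _].
- case: (first_stopP T v) => [[k [kv Tk] Tj]|[lt _]].
    by rewrite (PE k) //; case: (hP _ Tk) => -[h0 _ _] _.
  by rewrite /P leqNgt lt /= G0.
- case: (first_stopP T v) => [[k [kv Tk] Tj]|[lt Tj]]; last first.
    rewrite {3}/P leqNgt lt /=; have nTv : ~~ T v by rewrite -(take_size v) Tj.
    by apply: le_trans (sG v nTv); apply: lerD; apply: PG => j;
      rewrite size_rcons ltnS => jv; rewrite take_rc // Tj.
  have Pb b : P (rcons v b) = h (take k v) (rcons v b).
    rewrite (PE k) ?take_rc ?size_rcons //; first exact: leqW.
    by move=> j jk; rewrite take_rc ?Tj // ltnW // (leq_trans jk).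
  rewrite !Pb (PE k) //; case: (hP _ Tk) => -[_ sh _] _; apply: sh.
  exact: prefix_take.
- have ex := AT a Aa; case: (ex_minnP ex) => m Tm mmin.
  have [[_ _ hA] _] := hP _ Tm.
  have [k] := hA a Aa (cyl_mkseq a m); rewrite size_mkseq => mk qk.
  exists k => //.
  have take_mk j : (j <= m)%N -> take j (mkseq a k) = mkseq a j.
    move=> jm; rewrite /mkseq -map_take take_iota.
    by rewrite (minn_idPl (leq_trans jm mk)).
  rewrite (PE m) ?size_mkseq ?take_mk // => j jm.
  by rewrite take_mk ?(ltnW jm) //; apply/negP => /mmin; rewrite leqNgt jm.
Qed.

(* Covering each cylinder of a covering again, near-optimally, lowers the cost
   by a constant factor. *)
Lemma content_thin0 B (theta : R) : 0 <= theta -> theta < 1 ->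
  (forall w, content w B <= theta * q ^+ size w) -> content [::] B = 0.
Proof.
move=> t0 t1 thin; pose t := (1 + theta) / 2.
have [tgt0 tgt tlt1] : [/\ 0 < t, theta < t & t < 1] by rewrite /t; split; lra.
have /choice[h hP] w : exists g, covering w B g /\ g w <= t * q ^+ size w.
  have [|g cg /ltW ltg] := @content_ltP _ _ q_gt0 w B (t * q ^+ size w).
    by apply: le_lt_trans (thin w) _; rewrite ltr_pM2r // exprn_gt0.
  by exists g.
have key : content [::] B / t <= content [::] B.
  apply: lb_le_inf; first by case: (content_has_inf q_gt0 [::] B).
  move=> _ [g [g0 sg gB] <-]; rewrite ler_pdivrMr // mulrC.
  apply: (@content_paste (fun w => q ^+ size w <= g w) h (fun w => t * g w)).
  - by move=> v; rewrite mulr_ge0 // ltW.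
  - by move=> v _; rewrite -mulrDr ler_pM2l //; apply: sg; rewrite prefix0s.
  - move=> w qw; have [cw hw] := hP w; split=> //.
    by apply: le_trans hw _; rewrite ler_pM2l.
  - by move=> a Ba; have [k _ qk] := gB a Ba erefl; exists k; rewrite size_mkseq.
apply/eqP; rewrite eq_le content_ge0 // andbT leNgt; apply/negP => Bgt0.
move: key; rewrite ler_pdivrMr // => key.
suff : t * content [::] B < content [::] B by rewrite mulrC ltNge key.
by rewrite -[ltRHS]mul1r ltr_pM2r.
Qed.

(* Stop at the first cylinder whose limiting content is at least theta times
   its weight: the cylinders reached cost at most c / theta, and the points that
   are never stopped form a set of content 0. *)
Lemma content_nondecreasing (A : nat -> set (nat -> bool)) (c : R) :
  (forall i j, (i <= j)%N -> A i `<=` A j) ->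
  (forall i, content [::] (A i) <= c) -> content [::] (\bigcup_i A i) <= c.
Proof.
move=> Amono Ac.
have c0 : 0 <= c by apply: le_trans (Ac 0%N); exact: content_ge0.
pose m w := sup [set content w (A i) | i in [set: nat]].
have ubm w : has_ubound [set content w (A i) | i in [set: nat]].
  by exists (q ^+ size w) => _ [i _ <-]; exact: content_le_pow.
have Am w i : content w (A i) <= m w by apply: ub_le_sup => //; exists i.
have mle w x : (forall i, content w (A i) <= x) -> m w <= x.
  move=> Ax; apply: ge_sup => [|_ [i _ <-]//].
  by exists (content w (A 0%N)), 0%N.
have key theta : 0 < theta -> theta < 1 -> theta * content [::] (\bigcup_i A i) <= c.
  move=> t0 t1.
  pose T w := theta * q ^+ size w <= m w.
  pose A1 := [set a | (\bigcup_i A i) a /\ exists k, T (mkseq a k)].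
  pose A2 := \bigcup_i [set a | A i a /\ forall k, ~~ T (mkseq a k)].
  have subA : \bigcup_i A i `<=` A1 `|` A2.
    move=> a [i _ Aia]; have [[k Tk]|nT] := pselect (exists k, T (mkseq a k)).
      by left; split; [exists i|exists k].
    by right; exists i => //; split=> // k; apply/negP => Tk; apply: nT; exists k.
  have A2_0 : content [::] A2 = 0.
    apply: content_bigcup0 => // i; apply: (@content_thin0 _ theta) => //.
      exact: ltW.
    move=> w; have [[a [[Aia nT] wa]]|empty] :=
      pselect (exists a, [set a | A i a /\ forall k, ~~ T (mkseq a k)] a /\ cyl w a).
      have := nT (size w); rewrite wa /T -ltNge => /ltW; apply: le_trans.
      by apply: le_trans (Am w i); apply: content_mono => // b [[]].
    rewrite content_set0 //; first by rewrite mulr_ge0 ?exprn_ge0 // ltW.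
    by move=> a [Ba wa]; apply: empty; exists a.
  have A1_c : content [::] A1 <= c / theta.
    apply: (@le_trans _ _ (m [::] / theta)); last first.
      by rewrite ler_pM2r ?invr_gt0 //; exact: mle.
    apply: (@content_paste T (single q) (fun w => m w / theta)).
    - move=> v; rewrite divr_ge0 ?(ltW t0) //.
      by apply: le_trans (Am v 0%N); exact: content_ge0.
    - move=> v; rewrite /T -ltNge => mv; rewrite -mulrDl ler_pM2r ?invr_gt0 //.
      have mq : m v < q ^+ size v.
        apply: lt_le_trans mv _; rewrite -[leRHS]mul1r ler_pM2r ?exprn_gt0 //.
        exact: ltW.
      rewrite -lerBrDr; apply: (mle) => i; rewrite lerBrDl -lerBrDr.
      apply: mle => j; rewrite lerBrDr; apply: le_trans (Am v (maxn i j)).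
      apply: le_trans (content_split q_gt0 (le_lt_trans (Am _ _) mq)).
      rewrite addrC; apply: lerD; apply: content_mono => // a [Aa _]; move: Aa.
        by apply: Amono; rewrite leq_maxl.
      by apply: Amono; rewrite leq_maxr.
    - move=> w; rewrite /T => Tw; split; first exact: covering_single.
      by rewrite /single eqxx ler_pdivlMr // mulrC.
    - by move=> a [_ [k Tk]]; exists k.
  rewrite mulrC -ler_pdivlMr //; apply: le_trans A1_c.
  rewrite -[leRHS]addr0 -A2_0; apply: le_trans (contentU q_gt0 _ _ _).
  by apply: content_mono => // a [/subA].
rewrite leNgt; apply/negP => lt.
set M := content _ _ in lt key.
have M0 : 0 < M by exact: le_lt_trans lt.
have := key ((c + M) / 2 / M).
rewrite divr_gt0 ?divr_gt0 ?ltr_wpDl // => /(_ erefl).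
rewrite ltr_pdivrMr // mul1r divfK ?gt_eqF // => H.
have : (c + M) / 2 < M by lra.
by move=> /H; lra.
Qed.

End ContentContinuity.
(** * Capacitability of Souslin sets *)

Lemma mkseq_eqP (T : Type) (a b : nat -> T) k :
  mkseq a k = mkseq b k <-> forall i, (i < k)%N -> a i = b i.
Proof.
elim: k => [|k IH]; first by split.
rewrite !mkseqS; split=> [/rcons_inj[/IH e ek] i|e].
  by rewrite ltnS leq_eqVlt => /predU1P[->|/e].
by congr rcons; [apply/IH => i ik; rewrite e // ltnW|rewrite e].
Qed.

Lemma mkseq_le (T : Type) (a b : nat -> T) j k : (j <= k)%N ->
  mkseq a k = mkseq b k -> mkseq a j = mkseq b j.
Proof.
by move=> jk /mkseq_eqP e; apply/mkseq_eqP => i ij; apply/e/(leq_trans ij).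
Qed.

Lemma mkseq_chain (T : Type) (Q : seq T -> Prop) : Q [::] ->
  (forall p, Q p -> exists x, Q (rcons p x)) ->
  exists z : nat -> T, forall k, Q (mkseq z k).
Proof.
move=> Q0 QS; have /choice[nx nxP] (p : {p | Q p}) : exists x, Q (rcons (sval p) x).
  by case: p => p Qp; exact: QS.
pose F := fix F k : {p | Q p} := if k is k'.+1 then exist _ _ (nxP (F k'))
  else exist _ _ Q0.
exists (fun i => nx (F i)) => k.
suff -> : mkseq (fun i => nx (F i)) k = sval (F k) by apply: svalP.
by elim: k => // k IH; rewrite mkseqS IH.
Qed.

Lemma konig_nat (z : nat -> nat -> nat) (b : nat -> nat) :
  (forall k i, (i < k)%N -> (z k i <= b i)%N) ->
  exists y, forall k, exists2 l, (k <= l)%N & mkseq (z l) k = mkseq y k.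
Proof.
move=> zb.
pose Q p := forall k, exists2 l, (k <= l)%N & mkseq (z l) (size p) = p.
have [||y yP] := @mkseq_chain nat Q.
- by move=> k; exists k.
- move=> p Qp; apply: contrapT => nQ.
  have /choice[K KP] x : exists k, forall l, (k <= l)%N ->
      mkseq (z l) (size p) = p -> z l (size p) != x.
    apply: contrapT => nK; apply: nQ; exists x => k.
    apply: contrapT => nl; apply: nK; exists k => l kl pl; apply/eqP => zx.
    by apply: nl; exists l => //; rewrite size_rcons mkseqS pl zx.
  have [l] := Qp (maxn (size p).+1 (\max_(x < (b (size p)).+1) K x)).
  rewrite geq_max => /andP[pl Kl] lp.
  have zl := zb _ _ pl.
  suff : z l (size p) != z l (size p) by rewrite eqxx.
  apply: KP => //; apply: leq_trans Kl.
  exact: (@leq_bigmax _ (fun x : 'I_(b (size p)).+1 => K x) (@Ordinal (b (size p)).+1 _ zl)).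
- by exists y => k; have [l kl] := yP k k; rewrite size_mkseq; exists l.
Qed.

Lemma konig (a : nat -> nat -> bool) (y : nat -> nat -> nat) (b : nat -> nat) :
  (forall k i, (i < k)%N -> (y k i <= b i)%N) ->
  exists a' y', forall k, exists l, [/\ (k <= l)%N,
    mkseq (a l) k = mkseq a' k & mkseq (y l) k = mkseq y' k].
Proof.
move=> yb.
have [|z zP] := @konig_nat (fun k i => a k i + (y k i).*2)%N
    (fun i => (b i).*2.+1).
  by move=> k i ik; case: (a k i); rewrite ?add1n ?add0n ?ltnS ?leqW // leq_double yb.
exists (fun i => odd (z i)), (fun i => (z i)./2) => k.
have [l kl /mkseq_eqP e] := zP k.
exists l; split=> //; apply/mkseq_eqP => i ik; rewrite -(e i ik).
  by rewrite oddD odd_double addbF oddb.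
by rewrite half_bit_double.
Qed.

Definition souslin_scheme (P : nat -> (nat -> bool) -> (nat -> nat) -> Prop) :=
  forall k a a' y y', mkseq a k = mkseq a' k -> mkseq y k = mkseq y' k ->
    P k a y -> P k a' y'.

Definition souslin (A : set (nat -> bool)) :=
  exists2 P, souslin_scheme P & forall a, A a <-> exists y, forall k, P k a y.

Definition cyl_open (A : set (nat -> bool)) :=
  forall a, A a -> exists k, cyl (mkseq a k) `<=` A.

Definition cyl_closed (A : set (nat -> bool)) :=
  forall a, (forall k, exists2 b, A b & mkseq b k = mkseq a k) -> A a.

Lemma souslin_open A : cyl_open A -> souslin A.
Proof.
move=> oA; exists (fun k a y => (y 0%N < k)%N -> cyl (mkseq a (y 0%N)) `<=` A).
  move=> k a a' y y' ea /mkseq_eqP ey H y0k.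
  have e0 : y 0%N = y' 0%N by apply: ey; apply: leq_ltn_trans y0k.
  by rewrite -e0 -(mkseq_le _ ea) ?e0 1?ltnW // -e0; apply: H; rewrite e0.
move=> a; split=> [/oA[k kA]|[y yA]]; first by exists (fun=> k).
by apply: (yA (y 0%N).+1) => //; exact: cyl_mkseq.
Qed.

Lemma souslin_closed A : cyl_closed A -> souslin A.
Proof.
move=> cA; exists (fun k a _ => exists2 b, A b & mkseq b k = mkseq a k).
  by move=> k a a' _ _ e _ [b Ab be]; exists b => //; rewrite be.
move=> a; split=> [Aa|[_ aA]]; last exact: cA.
by exists (fun=> 0%N) => k; exists a.
Qed.

Lemma souslin_bigcup (A : nat -> set (nat -> bool)) :
  (forall m, souslin (A m)) -> souslin (\bigcup_m A m).
Proof.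
move=> sA; have /choice[P PP] m : exists P, souslin_scheme P /\
    forall a, A m a <-> exists y, forall k, P k a y.
  by have [P P1 P2] := sA m; exists P.
exists (fun k a y => (0 < k)%N -> P (y 0%N) k.-1 a (y \o S)).
  move=> k a a' y y' ea /mkseq_eqP ey H k0; rewrite -(ey _ k0).
  apply: (PP (y 0%N)).1 (H k0); first exact: mkseq_le (leq_pred _) ea.
  by apply/mkseq_eqP => i ik /=; apply: ey; rewrite -(prednK k0).
move=> a; split=> [[m _ /(PP m).2[y yP]]|[y yP]].
  by exists (fun i => if i is i'.+1 then y i' else m) => k k0.
by exists (y 0%N) => //; apply/(PP _).2; exists (y \o S) => k; apply: (yP k.+1).
Qed.

Lemma souslin_bigcap (A : nat -> set (nat -> bool)) :
  (forall m, souslin (A m)) -> souslin (\bigcap_m A m).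
Proof.
move=> sA; have /choice[P PP] m : exists P, souslin_scheme P /\
    forall a, A m a <-> exists y, forall k, P k a y.
  by have [P P1 P2] := sA m; exists P.
pose sub (m : nat) (y : nat -> nat) (i : nat) : nat := y (pickle (m, i)).
exists (fun k a y => forall m j, (j <= k)%N ->
    (forall i, (i < j)%N -> (pickle (m, i) < k)%N) -> P m j a (sub m y)).
  move=> k a a' y y' ea /mkseq_eqP ey H m j jk jP.
  apply: (PP m).1 (H m j jk jP); first exact: mkseq_le jk ea.
  by apply/mkseq_eqP => i ij; apply: ey; exact: jP.
move=> a; split=> [Aa|[y yP]].
  have /choice[y yP] m : exists y, forall k, P m k a y by apply/(PP m).2/Aa.
  exists (fun p => if unpickle p is Some (m, i) then y m i else 0%N) => k m j _ _.
  by apply: (PP m).1 (yP m j) => //; apply/mkseq_eqP => i _; rewrite /sub pickleK.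
move=> m _; apply/(PP m).2; exists (sub m y) => j.
apply: (yP (maxn j (\max_(i < j) (pickle (m, nat_of_ord i)).+1))); first exact: leq_maxl.
move=> i ij; apply: leq_trans (leq_maxr _ _).
exact: (@leq_bigmax _ (fun i : 'I_j => (pickle (m, nat_of_ord i)).+1) (Ordinal ij)).
Qed.

(* Bounding the coordinates of the witness one at a time keeps the content above
   c; by compactness the set with all coordinates bounded has content >= c. *)
Lemma souslin_capacitable (R : realType) (q : R) (A : set (nat -> bool)) (c : R) :
  0 < q -> souslin A -> c < content q [::] A ->
  exists Y, [/\ Y `<=` A, cyl_closed Y & c <= content q [::] Y].
Proof.
move=> q0 [P sP AP] cA.
pose D bs := [set a | exists2 y, forall k, P k a y &
  forall i, (i < size bs)%N -> (y i <= nth 0 bs i)%N].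
have [||b bP] := @mkseq_chain nat (fun bs => c < content q [::] (D bs)).
- apply: lt_le_trans cA _; apply: content_mono => // a [/AP[y yP] _].
  by exists y.
- move=> bs cD; apply: contrapT => nc.
  suff : content q [::] (D bs) <= c by rewrite leNgt cD.
  have <- : \bigcup_m D (rcons bs m) = D bs.
    apply/seteqP; split=> a [].
      move=> m _ [y yP yb]; exists y => // i ibs.
      by have := yb i; rewrite size_rcons nth_rcons ibs; apply; exact: leqW.
    move=> y yP yb; exists (y (size bs)) => //; exists y => // i.
    rewrite size_rcons ltnS nth_rcons leq_eqVlt => /predU1P[->|ib].
      by rewrite ltnn eqxx.
    by rewrite ib yb.
  apply: content_nondecreasing => // [i j ij a [y yP yb]|m]; last first.
    by rewrite leNgt; apply/negP => cm; apply: nc; exists m.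
  exists y => // k kb; apply: leq_trans (yb k _) _; first by move: kb; rewrite !size_rcons.
  by rewrite !nth_rcons; case: ifP => //; case: ifP.
exists [set a | exists2 y, forall k, P k a y & forall i, (y i <= b i)%N]; split.
- by move=> a [y yP _]; apply/AP; exists y.
- move=> a aY; have /choice[bb bbP] k : exists b', (exists2 y, forall k, P k b' y &
      forall i, (y i <= b i)%N) /\ mkseq b' k = mkseq a k.
    by have [b' Yb e] := aY k; exists b'.
  have /choice[y yP] k : exists y, (forall j, P j (bb k) y) /\ forall i, (y i <= b i)%N.
    by have [[y y1 y2] _] := bbP k; exists y.
  have [|a' [y' ayP]] := @konig bb y b; first by move=> k i _; case: (yP k).
  have aa' k : mkseq a' k = mkseq a k.
    have [l [kl <- _]] := ayP k; have [_ e] := bbP l; exact: mkseq_le kl e.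
  exists y' => [k|i].
    have [l [kl ea ey]] := ayP k; have [Pl _] := yP l.
    by apply: sP (Pl k); rewrite // ea.
  have [l [_ _ /mkseq_eqP ey]] := ayP i.+1.
  by rewrite -(ey i) //; case: (yP l).
- apply: lb_le_inf; first by case: (content_has_inf q0 [::]
    [set a | exists2 y, forall k, P k a y & forall i, (y i <= b i)%N]).
  move=> _ [g [g0 sg gY] <-]; apply: ltW.
  suff [k kg] : exists k, covering q [::] (D (mkseq b k)) g.
    by apply: lt_le_trans (bP k) _; exact: content_le.
  apply: contrapT => nk.
  have /choice[a aP] k : exists a, D (mkseq b k) a /\ forall j, g (mkseq a j) < q ^+ j.
    apply: contrapT => na; apply: nk; exists k; split=> // a Da _.
    apply: contrapT => nj; apply: na; exists a; split=> // j.
    by rewrite ltNge; apply/negP => gj; apply: nj; exists j.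
  have /choice[y yP] k : exists y, (forall j, P j (a k) y) /\
      forall i, (i < k)%N -> (y i <= b i)%N.
    have [[y y1 y2] _] := aP k; exists y; split=> // i ik.
    by have := y2 i; rewrite size_mkseq nth_mkseq //; apply.
  have [|a' [y' ayP]] := @konig a y b; first by move=> k; case: (yP k).
  have [|//|k _] := gY a'.
    exists y' => [k|i].
      have [l [kl ea ey]] := ayP k; have [Pl _] := yP l.
      exact: sP ea ey (Pl k).
    have [l [il _ /mkseq_eqP ey]] := ayP i.+1.
    by rewrite -(ey i) //; case: (yP l) => _; apply.
  have [l [kl <- _]] := ayP k.
  by rewrite leNgt; case: (aP l) => _ ->.
Qed.
(** * Coding a cube by binary sequences *)

Definition binary (p : seq bool) : nat :=
  foldl (fun m (b : bool) => (m.*2 + b)%N) 0%N p.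

Lemma binary_rcons p b : binary (rcons p b) = ((binary p).*2 + b)%N.
Proof. by rewrite /binary foldl_rcons. Qed.

Lemma binary_inj p p' : size p = size p' -> binary p = binary p' -> p = p'.
Proof.
elim/last_ind: p p' => [|p b IH] p'; first by case: p'.
case/lastP: p' => [|p' b']; first by rewrite size_rcons.
rewrite !size_rcons !binary_rcons => -[/IH{}IH] e.
have eb : b = b' by have := congr1 odd e; rewrite !oddD !odd_double !addFb !oddb.
by subst b'; rewrite IH //; apply: double_inj; move/addIn: e.
Qed.

Section BinaryExpansion.
Variable R : realType.
Implicit Types c : nat -> bool.

Let lo c k : R := (binary (mkseq c k))%:R / 2 ^+ k.
Let hi c k : R := (binary (mkseq c k)).+1%:R / 2 ^+ k.

Let pow2_gt0 k : 0 < 2 ^+ k :> R. Proof. by rewrite exprn_gt0. Qed.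

Let lo_S c k : lo c k <= lo c k.+1.
Proof.
rewrite /lo mkseqS binary_rcons ler_pdivrMr // exprS invfM mulrA.
rewrite divfK ?gt_eqF // ler_pdivlMr // -natrM ler_nat muln2.
exact: leq_addr.
Qed.

Let hi_S c k : hi c k.+1 <= hi c k.
Proof.
rewrite /hi mkseqS binary_rcons ler_pdivlMr // exprS invfM mulrA.
rewrite divfK ?gt_eqF // ler_pdivrMr // -natrM ler_nat muln2 doubleS.
by rewrite !ltnS -addn1 leq_add2l leq_b1.
Qed.

Let lo_hi c j k : lo c j <= hi c k.
Proof.
apply: (@le_trans _ _ (lo c (maxn j k))).
  rewrite -(subnKC (leq_maxl j k)); elim: (_ - _)%N => [|i IH]; first by rewrite addn0.
  by rewrite addnS (le_trans IH).
apply: (@le_trans _ _ (hi c (maxn j k))).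
  by rewrite ler_pM2r ?invr_gt0 // ler_nat.
rewrite -(subnKC (leq_maxr j k)); elim: (_ - _)%N => [|i IH]; first by rewrite addn0.
by rewrite addnS (le_trans _ IH).
Qed.

Definition binary_val c : R :=
  sup [set (binary (mkseq c k))%:R / 2 ^+ k | k in [set: nat]].

Lemma binary_val_ge c k : (binary (mkseq c k))%:R / 2 ^+ k <= binary_val c.
Proof.
apply: ub_le_sup; last by exists k.
by exists (hi c 0%N) => _ [j _ <-]; exact: lo_hi.
Qed.

Lemma binary_val_le c k : binary_val c <= (binary (mkseq c k)).+1%:R / 2 ^+ k.
Proof.
apply: ge_sup; first by exists (lo c 0%N), 0%N.
by move=> _ [j _ <-]; exact: lo_hi.
Qed.

Lemma binary_val_close c c' k : mkseq c k = mkseq c' k ->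
  `|binary_val c - binary_val c'| <= (2 ^+ k)^-1.
Proof.
move=> e; have := binary_val_ge c k; have := binary_val_le c k.
have := binary_val_ge c' k; have := binary_val_le c' k.
rewrite e -natr1 mulrDl mul1r ler_norml => *; lra.
Qed.

Lemma pow2_small (e : R) : 0 < e -> exists k, (2 ^+ k)^-1 < e.
Proof.
move=> e0; exists (Num.truncn e^-1).+1.
rewrite invf_plt ?posrE //; apply: lt_le_trans (truncnS_gt _) _.
by rewrite -natrX ler_nat ltnW // ltn_expl.
Qed.

Lemma binary_val_surj (x : R) : 0 <= x <= 1 -> exists c, binary_val c = x.
Proof.
move=> /andP[x0 x1].
have [||c cP] := @mkseq_chain bool (fun p =>
    (binary p)%:R / 2 ^+ size p <= x <= (binary p).+1%:R / 2 ^+ size p).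
- by rewrite /= expr0 divr1 x0 divr1 x1.
- move=> p /andP[xl xh]; pose b := (binary p).*2.+1%:R / 2 ^+ (size p).+1 <= x.
  have E (m : nat) : m.*2%:R / 2 ^+ (size p).+1 = m%:R / 2 ^+ size p :> R.
    by rewrite -mul2n natrM exprS invfM mulrACA divff ?mul1r ?pnatr_eq0.
  exists b; rewrite binary_rcons size_rcons.
  have [bt|] := boolP b; first by rewrite addn1 -doubleS E xh andbT.
  by rewrite addn0 E xl /b -ltNge => /ltW ->.
exists c; apply/eqP; rewrite eq_sym -subr_eq0 -normr_le0.
apply/ler_addgt0Pl => e /pow2_small[k ke]; rewrite addr0.
apply: le_trans (ltW ke).
have := cP k; have := binary_val_ge c k; have := binary_val_le c k.
rewrite size_mkseq -natr1 mulrDl mul1r ler_norml.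
by move=> ? ? /andP[? ?]; lra.
Qed.

End BinaryExpansion.

Section CubeCoding.
Variables (R : realType) (n : nat) (n_gt0 : (0 < n)%N).
Implicit Types (a b : nat -> bool) (z x y : 'rV[R]_n).

Definition bits_at a (j : 'I_n) k := a (n * k + j)%N.

Definition cube_pt z a : 'rV[R]_n := \row_j (z 0 j + binary_val R (bits_at a j)).

Lemma bits_at_mkseq a b (j : 'I_n) m : mkseq a m = mkseq b m ->
  mkseq (bits_at a j) (m %/ n) = mkseq (bits_at b j) (m %/ n).
Proof.
move=> /mkseq_eqP e; apply/mkseq_eqP => i im; apply: e.
have := leq_trunc_div m n; apply: leq_trans.
rewrite mulnC; apply: leq_trans (leq_mul im (leqnn n)).
by rewrite mulSn addnC mulnC ltn_add2r.
Qed.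

Lemma cube_pt_close z a b m j : mkseq a m = mkseq b m ->
  `|cube_pt z a 0 j - cube_pt z b 0 j| <= (2 ^+ (m %/ n))^-1.
Proof.
move=> e; rewrite !mxE opprD addrACA subrr add0r.
by apply: binary_val_close; exact: bits_at_mkseq.
Qed.

Lemma cube_pt_surj z x : (forall j, z 0 j <= x 0 j <= z 0 j + 1) ->
  exists a, cube_pt z a = x.
Proof.
move=> zx; have /choice[c cP] j : exists c, binary_val R c = x 0 j - z 0 j.
  apply: binary_val_surj; have /andP[? ?] := zx j.
  by rewrite subr_ge0 lerBlDl; apply/andP.
exists (fun i => c (Ordinal (ltn_pmod i n_gt0)) (i %/ n)%N).
apply/rowP => j; rewrite mxE.
rewrite (_ : bits_at _ j = c j); first by rewrite cP addrC subrK.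
apply/funext => k; rewrite /bits_at mulnC divnMDl // divn_small // addn0.
by congr c; apply/val_inj => /=; rewrite modnMDl modn_small.
Qed.

Lemma edist_le x y (t : R) : 0 <= t -> (forall j, `|x 0 j - y 0 j| <= t) ->
  Defs.edist x y <= n%:R * t.
Proof.
move=> t0 xy; have nt0 : 0 <= n%:R * t by rewrite mulr_ge0.
rewrite /Defs.edist -(ger0_norm nt0) -sqrtr_sqr ler_wsqrtr //.
apply: (@le_trans _ _ (\sum_(i < n) t ^+ 2)).
  by apply: ler_sum => i _; rewrite -real_normK ?num_real // lerXn2r ?nnegrE.
rewrite sumr_const card_ord -[leLHS]mulr_natl exprMn ler_wpM2r ?exprn_ge0 //.
by rewrite -natrX ler_nat -mulnn leq_pmulr.
Qed.

Lemma edist_ge x y j : `|x 0 j - y 0 j| <= Defs.edist x y.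
Proof.
rewrite -sqrtr_sqr /Defs.edist ler_wsqrtr // (bigD1 j) //= lerDl.
by apply: sumr_ge0 => i _; rewrite sqr_ge0.
Qed.

Lemma open_box (U : set 'rV[R]_n) x : open U -> U x ->
  exists2 e, 0 < e & forall y, (forall j, `|x 0 j - y 0 j| < e) -> U y.
Proof.
move=> oU Ux; have /nbhs_ballP[e e0 eU] : nbhs x U by exact: open_nbhs_nbhs.
by exists e => // y xy; apply: eU; split=> // i j; rewrite (ord1 i); exact: xy.
Qed.

Lemma cube_pt_open z (U : set 'rV[R]_n) : open U -> cyl_open (cube_pt z @^-1` U).
Proof.
move=> oU a /(open_box oU)[e e0 eU]; have [k ke] := pow2_small e0.
exists (n * k)%N => b; rewrite /cyl/= size_mkseq => eb; apply: eU => j.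
apply: le_lt_trans ke; rewrite -[in leRHS](mulKn k n_gt0).
by apply: cube_pt_close.
Qed.

Variables (s : R) (s_gt0 : 0 < s).

Definition cube_rate : R := 2 `^ (- (s / n%:R)).

Let nR_gt0 : 0 < n%:R :> R. Proof. by rewrite ltr0n. Qed.

Lemma cube_rate_gt0 : 0 < cube_rate. Proof. by rewrite powR_gt0. Qed.

Lemma cube_rateX m : cube_rate ^+ m = (2 `^ (- (m%:R / n%:R))) `^ s.
Proof.
rewrite /cube_rate -powR_mulrn ?powR_ge0 // -!powRrM; congr (_ `^ _).
by rewrite !mulNr; congr (- _); rewrite mulrAC [RHS]mulrAC [s * _]mulrC.
Qed.

Lemma cube_pt_edist z a b m : mkseq a m = mkseq b m ->
  Defs.edist (cube_pt z a) (cube_pt z b) `^ s <= (2 * n%:R) `^ s * cube_rate ^+ m.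
Proof.
move=> e; have t0 k : 0 <= (2 ^+ k)^-1 :> R by rewrite invr_ge0 exprn_ge0.
have ed := edist_le (t0 _) (fun j => cube_pt_close z j e).
rewrite cube_rateX -powRM ?powR_ge0 ?mulr_ge0 //.
apply: ge0_ler_powR; rewrite ?nnegrE ?sqrtr_ge0 ?mulr_ge0 ?powR_ge0 ?(ltW s_gt0) //.
apply: le_trans ed _; rewrite [2 * _]mulrC -mulrA ler_pM2l //.
rewrite -powR_mulrn // -powRN -[X in X * _]powRr1 // -powRD; last first.
  by rewrite pnatr_eq0 implybT.
apply: ler_powR; first by rewrite ler1n.
rewrite lerNl opprD opprK addrC -lerBrDr opprK.
rewrite ler_pdivrMr // natr1 -natrM ler_nat.
by rewrite mulSn addnC {1}(divn_eq m n) leq_add2l ltnW // ltn_pmod.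
Qed.

Lemma cube_pt_ball z x (r : R) : 0 < r -> r <= 1 ->
  exists ws : seq (seq bool), [/\ (size ws <= 5 ^ n)%N,
    forall w, w \in ws -> cube_rate ^+ size w <= 2 `^ s * r `^ s &
    forall a, eball x r (cube_pt z a) -> exists2 w, w \in ws & cyl w a].
Proof.
move=> r0 r1; have ex : exists k, (2 ^+ k)^-1 < r by exact: pow2_small.
have [k [kr rk]] : exists k, (2 ^+ k.+1)^-1 < r /\ r <= (2 ^+ k)^-1.
  case: (ex_minnP ex) => -[|k] kr kmin.
    by move: kr; rewrite expr0 invr1 ltNge r1.
  exists k; split=> //; rewrite leNgt; apply/negP => /kmin.
  by rewrite ltnn.
pose t j := (x 0 j - z 0 j) * 2 ^+ k; pose p j := Num.truncn (t j - 2).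
have /choice[W WP] (f : {ffun 'I_n -> 'I_5}) : exists w : seq bool, size w = (n * k)%N /\
    forall a, (forall j, binary (mkseq (bits_at a j) k) = (p j + f j)%N) -> cyl w a.
  have [[a aP]|na] := pselect (exists a, forall j,
      binary (mkseq (bits_at a j) k) = (p j + f j)%N); last first.
    exists (nseq (n * k) false); rewrite size_nseq; split=> // a aP.
    by case: na; exists a.
  exists (mkseq a (n * k)); rewrite size_mkseq; split=> // b bP.
  rewrite /cyl/= size_mkseq; apply/mkseq_eqP => i ik.
  pose j := Ordinal (ltn_pmod i n_gt0).
  have : mkseq (bits_at b j) k = mkseq (bits_at a j) k.
    by apply: binary_inj; rewrite ?size_mkseq // aP bP.
  move/mkseq_eqP => /(_ (i %/ n)%N); rewrite /bits_at /= mulnC -divn_eq.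
  by apply; rewrite ltn_divLR // mulnC.
exists [seq W f | f <- enum {: {ffun 'I_n -> 'I_5}}]; split.
- by rewrite size_map -cardE card_ffun !card_ord.
- move=> _ /mapP[f _ ->]; rewrite (WP f).1 cube_rateX natrM mulrAC divff ?gt_eqF //.
  rewrite mul1r powRN powR_mulrn // -powRM //; last exact: ltW.
  have k0 : 0 <= (2 ^+ k)^-1 :> R by rewrite invr_ge0 exprn_ge0.
  apply: ge0_ler_powR; rewrite ?nnegrE //; [exact: ltW|by rewrite mulr_ge0 // ltW|].
  by move: kr; rewrite exprS invfM => /ltW; rewrite -ler_pdivlMl // => ?; lra.
- move=> a xa; have pP j : (p j <= binary (mkseq (bits_at a j) k) < p j + 5)%N.
    have := le_trans (edist_ge x (cube_pt z a) j) (le_trans xa rk).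
    rewrite mxE ler_norml; set v := binary_val _ _.
    have := binary_val_ge R (bits_at a j) k; have := binary_val_le R (bits_at a j) k.
    set N := binary _; rewrite -/v.
    have k0 : 0 < 2 ^+ k :> R by rewrite exprn_gt0.
    rewrite ler_pdivlMr // ler_pdivrMr // => vN Nv /andP[].
    rewrite -(ler_pM2r k0) -(ler_pM2r k0 (_ - _)) mulNr mulVf ?gt_eqF // => h1 h2.
    have e : (x 0 j - (z 0 j + v)) * 2 ^+ k = t j - v * 2 ^+ k.
      by rewrite /t; ring.
    rewrite e in h1 h2; move: vN; rewrite -natr1 => vN.
    have [t0|t0] := leP 0 (t j - 2).
      have /andP[p1 p2] := truncn_itv t0.
      rewrite -/(p j) in p1 p2.
      apply/andP; split; rewrite -ltnS -(ltr_nat R) -?addnS ?natrD -?natr1.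
        by lra.
      by lra.
    have -> : p j = 0%N by apply/truncn0Pn; rewrite -ltNge; lra.
    by rewrite /= -(ltr_nat R); lra.
  exists (W [ffun j => inord (binary (mkseq (bits_at a j) k) - p j)]).
    by apply/mapP; eexists; [exact: mem_enum|].
  apply: (WP _).2 => j; have /andP[p1 p2] := pP j.
  by rewrite ffunE inordK ?subnKC // ltn_subLR.
Qed.

End CubeCoding.
(** * Frostman's lemma *)

Lemma measure_bigsetU_le d (T : measurableType d) (R : realType)
    (mu : {measure set T -> \bar R}) (I : Type) (r : seq I) (F : I -> set T) :
  (forall i, measurable (F i)) ->
  (mu (\big[setU/set0]_(i <- r) F i) <= \sum_(i <- r) mu (F i))%E.
Proof.
move=> mF; elim: r => [|i r IH]; first by rewrite !big_nil measure0.
rewrite !big_cons; apply: le_trans (measureU2 _ _ _) _ => //.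
  exact: bigsetU_measurable.
exact: leeD2l.
Qed.

Definition finite_pushforward d d' (T1 : measurableType d)
    (T2 : measurableType d') (R : realType)
    (m : {finite_measure set T1 -> \bar R}) (f : T1 -> T2)
    (mf : measurable_fun [set: T1] f) : set T2 -> \bar R := pushforward m f.

Section FinitePushforward.
Context d d' (T1 : measurableType d) (T2 : measurableType d') (R : realType).
Variables (m : {finite_measure set T1 -> \bar R}) (f : T1 -> T2).
Hypothesis mf : measurable_fun [set: T1] f.

Let finite_pushforward0 : finite_pushforward m mf set0 = 0%E.
Proof. by rewrite /finite_pushforward /pushforward preimage_set0 measure0. Qed.

Let finite_pushforward_ge0 A : (0 <= finite_pushforward m mf A)%E.
Proof. exact: measure_ge0. Qed.

Let finite_pushforward_sigma_additive :
  semi_sigma_additive (finite_pushforward m mf).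
Proof.
move=> F mF tF mUF; rewrite /finite_pushforward /pushforward preimage_bigcup.
apply: measure_semi_sigma_additive.
- by move=> n; rewrite -[X in measurable X]setTI; exact: mf.
- apply/trivIsetP => /= i j _ _ ij; rewrite -preimage_setI.
  by move/trivIsetP : tF => /(_ _ _ _ _ ij) ->//; rewrite preimage_set0.
- by rewrite -preimage_bigcup -[X in measurable X]setTI; exact: mf.
Qed.

HB.instance Definition _ := isMeasure.Build _ _ _ (finite_pushforward m mf)
  finite_pushforward0 finite_pushforward_ge0 finite_pushforward_sigma_additive.

Let finite_pushforward_fin : fin_num_fun (finite_pushforward m mf).
Proof.
move=> A mA; apply: fin_num_measure.
by rewrite -[X in measurable X]setTI; exact: mf.
Qed.

HB.instance Definition _ :=
  Measure_isFinite.Build _ _ _ (finite_pushforward m mf) finite_pushforward_fin.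

End FinitePushforward.

Section TreeMeasure.
Variables (R : realType) (q : R) (q_gt0 : 0 < q) (Y : set (nat -> bool)).
Hypothesis clY : cyl_closed Y.
Implicit Types (w : seq bool) (u : R).

Local Notation total := (content q [::] Y).

Fixpoint left_rev (p : seq bool) : set (nat -> bool) :=
  if p is b :: p' then
    if b then left_rev p' `|` cyl (rcons (rev p') false) else left_rev p'
  else set0.

(* The sequences that are lexicographically below the cylinder of w. *)
Definition left_of w := left_rev (rev w).

Lemma left_of_rcons w b : left_of (rcons w b) =
  if b then left_of w `|` cyl (rcons w false) else left_of w.
Proof. by rewrite /left_of rev_rcons /= revK. Qed.

Let left_end w : R := content q [::] (Y `&` left_of w).
Let right_end w : R := content q [::] (Y `&` (left_of w `|` cyl w)).

Let cyl_split w : cyl w = cyl (rcons w false) `|` cyl (rcons w true).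
Proof.
apply/seteqP; split=> [a wa|a [|] /cyl_rcons[]//].
by case b: (a (size w)); [right|left]; apply/cyl_rcons.
Qed.

Let right_end_true w : right_end (rcons w true) = right_end w.
Proof. by rewrite /right_end left_of_rcons -setUA -cyl_split. Qed.

Let right_end_false w : right_end (rcons w false) = left_end (rcons w true).
Proof. by rewrite /right_end /left_end !left_of_rcons. Qed.

Let left_end_false w : left_end (rcons w false) = left_end w.
Proof. by rewrite /left_end left_of_rcons. Qed.

Let right_left w : right_end w <= left_end w + q ^+ size w.
Proof.
rewrite /right_end setIUr; apply: le_trans (contentU q_gt0 _ _ _) _.
by rewrite lerD2l; exact: content_cyl.
Qed.

Fixpoint word_of u k : seq bool :=
  if k is k'.+1 then
    rcons (word_of u k') (left_end (rcons (word_of u k') true) <= u)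
  else [::].

Definition digits u i : bool := left_end (rcons (word_of u i) true) <= u.

Lemma mkseq_digits u k : mkseq (digits u) k = word_of u k.
Proof. by elim: k => // k IH; rewrite mkseqS IH. Qed.

Lemma size_word_of u k : size (word_of u k) = k.
Proof. by rewrite -mkseq_digits size_mkseq. Qed.

Lemma word_of_itv u k : 0 <= u < total ->
  left_end (word_of u k) <= u < right_end (word_of u k).
Proof.
move=> uT; elim: k => [|k /andP[l r]] /=.
  have -> : left_end [::] = 0 by apply: content_set0 => // a [[]].
  have -> // : right_end [::] = total.
  by congr (content q [::] _); apply/seteqP; split=> [a []|a Ya] //; split; last right.
have [h|h] := leP (left_end (rcons (word_of u k) true)) u.
  by rewrite h right_end_true r.
by rewrite left_end_false l right_end_false h.
Qed.

Lemma digits_in u : 0 <= u < total -> Y (digits u).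
Proof.
move=> uT; apply: clY => k; apply: contrapT => nY.
have /andP[l r] := word_of_itv k uT; have := le_lt_trans l r.
rewrite ltNge => /negP; apply; apply: content_mono => // a [[Ya [//|wa]] _].
case: nY; exists a => //; move: wa.
by rewrite /cyl/= size_word_of mkseq_digits.
Qed.

Lemma measurable_word_of k w :
  measurable ([set u | word_of u k = w] : set (measurableTypeR R)).
Proof.
elim: k w => [|k IH] w /=.
  have [->|w0] := pselect (w = [::]).
    by rewrite (_ : [set _ | _] = setT) //; apply/seteqP; split.
  rewrite (_ : [set _ | _] = set0) //; apply/seteqP; split=> // u /= e.
  by case: w0.
case/lastP: w => [|w b].
  rewrite (_ : [set _ | _] = set0) //; apply/seteqP; split=> // u /=.
  by move/(congr1 size); rewrite size_rcons.
rewrite (_ : [set _ | _] = [set u | word_of u k = w] `&`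
   [set` if b then `[left_end (rcons w true), +oo[
    else `]-oo, left_end (rcons w true)[]).
  by apply: measurableI; [exact: IH|case: b; exact: measurable_itv].
apply/seteqP; split=> u /=.
  move=> /rcons_inj[-> <-]; split=> //.
  by case: (leP (left_end (rcons w true)) u) => h; rewrite in_itv /= ?andbT.
move=> [->]; case: b; rewrite in_itv /= ?andbT => h; first by rewrite h.
by rewrite leNgt h.
Qed.

Lemma measurable_digits n (h : (nat -> bool) -> 'rV[R]_n) :
  (forall U : set 'rV[R]_n, open U -> cyl_open (h @^-1` U)) ->
  measurable_fun [set: measurableTypeR R] (h \o digits : _ -> borelRn R n).
Proof.
move=> hU; apply: (@measurability _ _ (measurableTypeR R) (borelRn R n) _
  (h \o digits) (opens R n)) => //.
move=> _ [U oU <-]; rewrite setTI.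
rewrite (_ : _ @^-1` _ =
  \bigcup_(w : seq bool) [set u | word_of u (size w) = w /\ cyl w `<=` h @^-1` U]).
  apply: countable_bigcupT_measurable; first exact: countableP.
  move=> w; have [sw|nsw] := pselect (cyl w `<=` h @^-1` U).
    rewrite (_ : [set _ | _] = [set u | word_of u (size w) = w]).
      exact: measurable_word_of.
    by apply/seteqP; split=> [u []|u].
  by rewrite (_ : [set _ | _] = set0) //; apply/seteqP; split=> [u []|].
apply/seteqP; split=> [u hu|u [w _ [uw sw]]].
  have [k kU] := hU U oU _ hu; exists (mkseq (digits u) k) => //.
  by split=> //; rewrite size_mkseq mkseq_digits.
by apply: sw; rewrite /cyl/= mkseq_digits.
Qed.

Lemma tree_measure n (h : (nat -> bool) -> 'rV[R]_n) :
  (forall U : set 'rV[R]_n, open U -> cyl_open (h @^-1` U)) ->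
  exists mu : {finite_measure set (borelRn R n) -> \bar R},
    (forall B : set 'rV[R]_n, h @` Y `<=` B -> mu B = total%:E) /\
    (forall (B : set 'rV[R]_n) (ws : seq (seq bool)),
      measurable (B : set (borelRn R n)) ->
      (forall a, B (h a) -> exists2 w, w \in ws & cyl w a) ->
      (mu B <= (\sum_(w <- ws) q ^+ size w)%:E)%E).
Proof.
move=> hU.
have mD : measurable (`[0, total[ : set (measurableTypeR R)).
  exact: measurable_itv.
have T0 : 0 <= total by exact: content_ge0.
have lebD : (@lebesgue_measure R `[0%R, total[%classic = total%:E)%E.
  rewrite lebesgue_measure_itv /= lte_fin; case: ltP => [_|]; first by rewrite oppr0 adde0.
  by move=> T0'; congr (_%:E); apply/eqP; rewrite eq_le T0 T0'.
have foo : (@lebesgue_measure R `[0%R, total[%classic < +oo)%E.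
  by rewrite lebD ltry.
pose m : {finite_measure set (measurableTypeR R) -> \bar R} := mfrestr mD foo.
exists (finite_pushforward m (measurable_digits hU)); split=> [B YB|B ws mB Bws].
  rewrite /= /finite_pushforward /pushforward /m /= /mfrestr /mrestr -lebD.
  congr lebesgue_measure; apply/setIidr => u /=; rewrite in_itv /= => uT.
  by apply: YB; exists (digits u) => //; exact: digits_in.
rewrite /= /finite_pushforward /pushforward /m /= /mfrestr /mrestr.
have mE w : measurable ([set u | word_of u (size w) = w] `&` `[0, total[ :
    set (measurableTypeR R)).
  by apply: measurableI => //; exact: measurable_word_of.
have mBD : measurable (((h \o digits) @^-1` B `&` `[0, total[) : set (measurableTypeR R)).
  apply: measurableI => //; rewrite -[X in measurable X]setTI.
  exact: measurable_digits.
apply: (@le_trans _ _ (@lebesgue_measure R (\big[setU/set0]_(w <- ws)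
    ([set u | word_of u (size w) = w] `&` `[0, total[)))).
  apply: le_measure; rewrite ?inE //; first exact: bigsetU_measurable.
  move=> u [Bu uT]; have [w wws wu] := Bws _ Bu.
  rewrite -bigcup_seq; exists w => //; split=> //=.
  by rewrite -mkseq_digits.
apply: (@le_trans _ _ (\sum_(w <- ws) @lebesgue_measure R
    ([set u | word_of u (size w) = w] `&` `[0%R, total[))%E).
  exact: measure_bigsetU_le.
rewrite -sumEFin; apply: lee_sum => w _.
apply: (@le_trans _ _ (@lebesgue_measure R `[left_end w, right_end w[%classic)).
  apply: le_measure; rewrite ?inE; [exact: mE|exact: measurable_itv|].
  move=> u [/= wu]; rewrite !in_itv /= => uT.
  by have := word_of_itv (size w) uT; rewrite wu.
rewrite lebesgue_measure_itv /=; case: ifP => _.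
  by rewrite -EFinB lee_fin lerBlDl right_left.
by rewrite lee_fin exprn_ge0 // ltW.
Qed.

End TreeMeasure.
Fixpoint words (L : nat) : seq (seq bool) :=
  if L is L'.+1 then
    [::] :: [seq false :: v | v <- words L'] ++ [seq true :: v | v <- words L']
  else [:: [::]].

Lemma mem_words L w : (size w <= L)%N -> w \in words L.
Proof.
elim: L w => [|L IH] [|b w] //=; rewrite ltnS => wL.
by rewrite inE mem_cat; apply/orP; right; apply/orP;
  case: b; [right|left]; apply: map_f; exact: IH.
Qed.

Lemma uniq_words L : uniq (words L).
Proof.
have inj (b : bool) : injective (cons b) by move=> u v [].
elim: L => //= L IH; rewrite mem_cat cat_uniq !(map_inj_uniq (inj _)) IH /= andbT.
apply/andP; split.
  by apply/negP => /orP[] /mapP[].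
by apply/hasPn => _ /mapP[v _ ->]; apply/negP => /mapP[].
Qed.

(* The words of W are pairwise incomparable, so that the cost of the covering
   by their cylinders is at most the value at the root of the superadditive g. *)
Lemma sum_antichain (R : realType) (g : seq bool -> R) (W : pred (seq bool)) L w :
  (forall v, 0 <= g v) -> superadditive_below [::] g ->
  (forall v u, W v -> u != [::] -> ~~ W (v ++ u)) ->
  \sum_(v <- words L | W (w ++ v)) g (w ++ v) <= g w.
Proof.
move=> g0 sg anti; elim: L w => [|L IH] w /=.
  by rewrite big_cons big_nil cats0; case: ifP; rewrite ?addr0.
rewrite big_cons cats0; case: ifP => [Ww|_].
  rewrite big1_seq ?addr0 // => v /andP[Wv]; rewrite mem_cat => vw.
  have v0 : v != [::] by case/orP: vw => /mapP[? _ ->].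
  by move: Wv; rewrite (negbTE (anti _ _ Ww v0)).
rewrite big_cat /= !big_map.
apply: le_trans (sg w (prefix0s _)).
have E b : \sum_(j <- words L | W (w ++ b :: j)) g (w ++ b :: j) =
    \sum_(j <- words L | W (rcons w b ++ j)) g (rcons w b ++ j).
  by apply: eq_big => [j|j _]; rewrite cat_rcons.
by rewrite !E; apply: lerD; exact: IH.
Qed.

Lemma ler_sum_uniq_sub (R : numDomainType) (I : eqType) (r r' : seq I)
    (F : I -> R) : uniq r -> uniq r' -> {subset r <= r'} ->
  (forall i, 0 <= F i) -> \sum_(i <- r) F i <= \sum_(i <- r') F i.
Proof.
move=> ur ur' rr' F0; rewrite (perm_big [seq i <- r' | i \in r]) /=; last first.
  apply: uniq_perm; rewrite ?filter_uniq // => i; rewrite mem_filter.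
  by have [/rr' ->|] := boolP (i \in r).
rewrite big_filter big_mkcond /=; apply: ler_sum => i _.
by case: ifP.
Qed.

Lemma sum_pow2_le (R : realType) (r : seq nat) : uniq r ->
  \sum_(i <- r) (2 ^+ i.+1)^-1 <= 1 :> R.
Proof.
move=> ur; pose N := (\max_(i <- r) i).+1.
apply: (@le_trans _ _ (\sum_(i <- iota 0 N) (2 ^+ i.+1)^-1)).
  apply: ler_sum_uniq_sub => //; first exact: iota_uniq.
  by move=> i ir; rewrite mem_iota add0n ltnS (leq_bigmax_seq (F := id)).
apply: (@le_trans _ _ (1 - (2 ^+ N)^-1)); last first.
  by rewrite lerBlDr lerDl invr_ge0 exprn_ge0.
elim: N => [|N IH]; first by rewrite big_nil expr0 invr1 subrr.
rewrite -addn1 iotaD big_cat /= big_cons big_nil addr0 add0n addn1.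
apply: (le_trans (lerD IH (lexx _))).
by rewrite exprS invfM; set x := (_ ^+ N)^-1; lra.
Qed.

Section HausdorffNull.
Variables (R : realType) (n : nat) (n_gt0 : (0 < n)%N) (s : R) (s_gt0 : 0 < s).

Lemma diam_pow_le (U : set 'rV[R]_n) (c : R) : 0 <= c ->
  (forall x y, U x -> U y -> Defs.edist x y `^ s <= c) ->
  (Defs.diam U <= (c `^ s^-1)%:E)%E /\ (diam_pow s U <= c%:E)%E.
Proof.
move=> c0 Uc.
have dU : (Defs.diam U <= (c `^ s^-1)%:E)%E.
  apply: ge_ereal_sup => _ [x [y [Ux Uy ->]]]; rewrite lee_fin.
  have := Uc x y Ux Uy => /(ge0_ler_powR (ltW (_ : 0 < s^-1))).
  rewrite invr_gt0 s_gt0 => /(_ erefl); rewrite !nnegrE powR_ge0 c0.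
  by move=> /(_ erefl erefl); rewrite -powRrM mulfV ?gt_eqF // powRr1 ?sqrtr_ge0.
split=> //; rewrite /diam_pow; case: ifPn => [_|/set0P[x Ux]].
  by rewrite lee_fin.
have d0 : (0 <= Defs.diam U)%E.
  apply: ereal_sup_ubound; exists x, x; split=> //; congr (_%:E).
  rewrite /Defs.edist big1 ?sqrtr0 // => i _.
  by rewrite subrr expr0n.
have -> : c%:E = ((c `^ s^-1)%:E `^ s)%E.
  by rewrite poweR_EFin -powRrM mulVf ?gt_eqF // powRr1.
by apply: (gt0_ler_poweR (ltW s_gt0)); rewrite ?in_itv /= ?leey ?andbT // lee_fin powR_ge0.
Qed.

Let q : R := cube_rate n s.
Let q_gt0 : 0 < q. Proof. exact: cube_rate_gt0. Qed.

Definition int_pt (f : {ffun 'I_n -> int}) : 'rV[R]_n := \row_j (f j)%:~R.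

Lemma content_null_hausdorff_content (X : set 'rV[R]_n) (delta e : R) :
  0 < delta -> 0 < e ->
  (forall f, content q [::] (cube_pt (int_pt f) @^-1` X) = 0) ->
  (hausdorff_content s delta X <= e%:E)%E.
Proof.
move=> d0 e0 X0.
pose C : R := (2 * n%:R) `^ s.
have C0 : 0 < C by rewrite powR_gt0 // mulr_gt0 // ltr0n.
pose e' := Num.min e (delta `^ s) / C.
have e'0 : 0 < e' by rewrite divr_gt0 // lt_min e0 powR_gt0.
have Ce' : C * e' = Num.min e (delta `^ s) by rewrite mulrC divfK // gt_eqF.
have /choice[g gP] f : exists g, covering q [::] (cube_pt (int_pt f) @^-1` X) g /\
    g [::] < e' / 2 ^+ (pickle f).+1.
  have [|g cg ltg] := @content_ltP _ q q_gt0 [::] (cube_pt (int_pt f) @^-1` X)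
      (e' / 2 ^+ (pickle f).+1).
    by rewrite X0 divr_gt0 // exprn_gt0.
  by exists g.
have g_ge0 f v : 0 <= g f v by have [[]] := gP f.
have gs f : superadditive_below [::] (g f) by have [[]] := gP f.
have g_le f w : g f w <= e'.
  apply: le_trans (_ : g f [::] <= _); first exact: (@superadditive_le _ _ [::] w).
  have [_ /ltW] := gP f; move/le_trans; apply.
  rewrite ler_pdivrMr ?exprn_gt0 // ler_peMr ?(ltW e'0) //.
  by rewrite exprn_ege1 // ler1n.
pose W f w := (q ^+ size w <= g f w) &&
  all (fun k => g f (take k w) < q ^+ k) (iota 0 (size w)).
have anti f v u : W f v -> u != [::] -> ~~ W f (v ++ u).
  move=> /andP[qv _] u0; apply/negP => /andP[_ /allP/(_ (size v))].
  rewrite mem_iota add0n size_cat /= -[X in (X < _)%N]addn0 ltn_add2l lt0n size_eq0 u0.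
  by move=> /(_ erefl); rewrite take_size_cat // ltNge qv.
pose I := ({ffun 'I_n -> int} * seq bool)%type.
pose om (x : I) : R := if W x.1 x.2 then q ^+ size x.2 else 0.
pose UI (x : I) : set 'rV[R]_n :=
  if W x.1 x.2 then cube_pt (int_pt x.1) @` cyl x.2 else set0.
have om0 x : 0 <= om x by rewrite /om; case: ifP => // _; rewrite exprn_ge0 // ltW.
have UIP x : (Defs.diam (UI x) <= delta%:E)%E /\ (diam_pow s (UI x) <= (C * om x)%:E)%E.
  have [||dU pU] := @diam_pow_le (UI x) (C * om x).
  - by rewrite mulr_ge0 // ltW.
  - rewrite /UI /om; case: ifP => // _ _ _ [a xa <-] [b xb <-].
    by apply: cube_pt_edist => //; rewrite xa xb.
  split=> //; apply: le_trans dU _; rewrite lee_fin.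
  have -> : delta = (delta `^ s) `^ s^-1.
    by rewrite -powRrM mulfV ?gt_eqF // powRr1 // ltW.
  apply: ge0_ler_powR; rewrite ?nnegrE ?powR_ge0 ?invr_ge0 ?mulr_ge0 ?(ltW s_gt0) ?(ltW C0) //.
  apply: le_trans (_ : C * e' <= _); last by rewrite Ce' ge_min lexx orbT.
  rewrite ler_pM2l // /om; case: ifP => [/andP[qg _]|_]; last exact: ltW.
  exact: le_trans qg (g_le _ _).
pose U i : set 'rV[R]_n := if pickle_inv i is Some x then UI x else set0.
have diam0 : Defs.diam (set0 : set 'rV[R]_n) = -oo%E.
  rewrite /Defs.diam (_ : [set _ | _] = set0) ?ereal_sup0 //.
  by apply/seteqP; split=> // d [x [y []]].
apply: le_trans (_ : (\sum_(0 <= i <oo) diam_pow s (U i) <= _)%E).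
  apply: ereal_inf_lbound; exists U; split=> //.
    move=> x Xx; pose f := [ffun j => Num.floor (x 0 j)] : {ffun 'I_n -> int}.
    have [a ax] : exists a, cube_pt (int_pt f) a = x.
      apply: cube_pt_surj => // j; rewrite mxE ffunE.
      by rewrite Num.Theory.floor_le /= -intrD1 ltW // floorD1_gt.
    have [[_ _ gX] _] := gP f.
    have [|//|k0 _ qk0] := gX a; first by rewrite /preimage /= ax.
    have ex : exists k, q ^+ k <= g f (mkseq a k) by exists k0.
    case: (ex_minnP ex) => k qk kmin.
    exists (pickle (f, mkseq a k)) => //; rewrite /U pickleK_inv /UI /=.
    rewrite ifT; first by exists a => //; exact: cyl_mkseq.
    rewrite /W size_mkseq qk /=; apply/allP => j; rewrite mem_iota add0n => /= jk.
    rewrite ltNge; apply/negP; rewrite {1}/mkseq -map_take take_iota.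
    by rewrite (minn_idPl (ltnW jk)) => /kmin; rewrite leqNgt jk.
  move=> i; rewrite /U; case: pickle_inv => [x|]; first by case: (UIP x).
  by rewrite diam0 leNye.
have dp0 i : (0 <= diam_pow s (U i))%E.
  by rewrite /diam_pow; case: ifP => // _; exact: poweR_ge0.
apply: lime_le; first by apply: is_cvg_nneseries => i _ _.
apply: nearW => N.
apply: (@le_trans _ _ (\sum_(0 <= i < N) (oapp (fun x => C * om x) 0 (pickle_inv i))%:E)%E).
  apply: lee_sum => i _; rewrite /U; case: (pickle_inv i) => [x|] /=.
    by case: (UIP x).
  by rewrite /diam_pow eqxx.
rewrite sumEFin lee_fin /index_iota subn0 -big_pmap.
set r := pmap _ _.
have ur : uniq r by apply: (pmap_uniq (g := pickle)); [exact: pickle_invK|exact: iota_uniq].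
pose fs := undup [seq x.1 | x <- r]; pose L := (\max_(x <- r) size x.2)%N.
rewrite -mulr_sumr.
apply: le_trans (_ : C * e' <= _); last by rewrite Ce' ge_min lexx.
rewrite ler_pM2l //.
apply: (@le_trans _ _ (\sum_(x <- [seq (f, w) | f <- fs, w <- words L]) om x)).
  apply: ler_sum_uniq_sub => //.
  - by apply: allpairs_uniq; rewrite ?undup_uniq ?uniq_words // => -[? ?] [? ?].
  - move=> [f w] fwr; apply: allpairs_f.
      by rewrite mem_undup; apply/mapP; exists (f, w).
    apply: mem_words.
    exact: (@leq_bigmax_seq _ r xpredT (fun x : I => size x.2) (f, w)).
rewrite big_allpairs /=.
apply: (@le_trans _ _ (\sum_(f <- fs) e' * (2 ^+ (pickle f).+1)^-1)).
  apply: ler_sum => f _; have [_ /ltW] := gP f; apply: le_trans.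
  apply: le_trans (sum_antichain L [::] (g_ge0 f) (gs f) (anti f)).
  rewrite /= [leRHS]big_mkcond /=; apply: ler_sum => w _; rewrite /om /=.
  by case: ifP => // /andP[].
rewrite -mulr_sumr -[leRHS]mulr1 ler_pM2l //.
rewrite -(big_map pickle xpredT (fun i => (2 ^+ i.+1)^-1)); apply: sum_pow2_le.
by rewrite map_inj_uniq ?undup_uniq //; exact: (pcan_inj pickleK).
Qed.

Lemma hausdorff_measure_content (X : set 'rV[R]_n) :
  hausdorff_measure s X <> 0%E ->
  exists f, 0 < content q [::] (cube_pt (int_pt f) @^-1` X).
Proof.
move=> hX; apply: contrapT => nf; apply: hX.
have X0 f : content q [::] (cube_pt (int_pt f) @^-1` X) = 0.
  apply/eqP; rewrite eq_le content_ge0 // andbT leNgt; apply/negP => lt.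
  by apply: nf; exists f.
have c0 delta : 0 < delta -> hausdorff_content s delta X = 0%E.
  move=> d0; apply/eqP; rewrite eq_le; apply/andP; split.
    apply/lee_addgt0Pr => e e0; rewrite add0e.
    exact: content_null_hausdorff_content.
  apply: le_ereal_inf_tmp => _ [U [_ _ ->]]; apply: nneseries_ge0 => i _ _.
  by rewrite /diam_pow; case: ifP => // _; exact: poweR_ge0.
rewrite /hausdorff_measure (_ : [set _ | _ in _] = [set 0%E]) ?ereal_sup1 //.
apply/seteqP; split=> [_ [d /= d0 <-]|_ ->]; first exact: c0.
by exists 1 => //=; exact: c0.
Qed.

End HausdorffNull.
Section Borel.
Variables (R : realType) (n : nat).
Implicit Types (U K : set 'rV[R]_n) (mu : {finite_measure set (borelRn R n) -> \bar R}).

Lemma open_borel U : open U -> measurable (U : set (borelRn R n)).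
Proof. by move=> oU; apply: sub_sigma_algebra. Qed.

Lemma closed_borel K : closed K -> measurable (K : set (borelRn R n)).
Proof.
by move=> cK; rewrite -[K]setCK; apply: measurableC; apply: open_borel; exact: closed_openC.
Qed.

Lemma continuous_fun_sub (T : topologicalType) (f g : T -> R) :
  continuous f -> continuous g -> continuous (fun x => f x - g x).
Proof. by move=> cf cg x; apply: cvgB; [exact: cf|exact: cg]. Qed.

Lemma continuous_fun_mul (T : topologicalType) (f g : T -> R) :
  continuous f -> continuous g -> continuous (fun x => f x * g x).
Proof. by move=> cf cg x; apply: cvgM; [exact: cf|exact: cg]. Qed.

Lemma continuous_sum (T : topologicalType) (I : Type) (r : seq I) (f : I -> T -> R) :
  (forall i, continuous (f i)) -> continuous (fun x => \sum_(i <- r) f i x).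
Proof.
move=> fc; elim: r => [|i r IH].
  by under eq_fun do rewrite big_nil; exact: cst_continuous.
by under eq_fun do rewrite big_cons; move=> x; apply: cvgD; [exact: fc|exact: IH].
Qed.

Lemma closed_coord (f : 'rV[R]_n -> R) (D : set R) : closed D -> continuous f ->
  closed (f @^-1` D).
Proof. by move=> cD cf; apply: closed_comp => // x _; exact: cf. Qed.

Lemma coord_sub_continuous (p : 'rV[R]_n) i :
  continuous (fun x : 'rV[R]_n => x 0 i - p 0 i : R).
Proof.
apply: continuous_fun_sub; last exact: cst_continuous.
exact: (@coord_continuous R 1 n).
Qed.

Lemma eball_closed (x : 'rV[R]_n) (r : R) : 0 <= r -> closed (eball x r).
Proof.
move=> r0; pose f (y : 'rV[R]_n) := \sum_(i < n) (x 0 i - y 0 i) ^+ 2.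
rewrite (_ : eball x r = f @^-1` [set t | t <= r ^+ 2]).
  apply: closed_coord; first exact: closed_le.
  apply: continuous_sum => i; apply: continuous_fun_mul;
    apply: continuous_fun_sub; try exact: cst_continuous;
    exact: (@coord_continuous R 1 n).
apply/seteqP; split=> y; rewrite /eball /Defs.edist /preimage /= -/(f y).
  have f0 : 0 <= f y by apply: sumr_ge0 => i _; exact: sqr_ge0.
  by move=> fr; rewrite -(sqr_sqrtr f0) lerXn2r // nnegrE // sqrtr_ge0.
by move=> fr; rewrite -(ger0_norm r0) -sqrtr_sqr ler_wsqrtr.
Qed.

Lemma aset_closed (V : affine R n) : closed (aset V).
Proof.
case: V => p D; rewrite /aset /=.
pose A i j : R := projv D (delta_mx 0 i) 0 j.
pose f j (x : 'rV[R]_n) := \sum_i (x 0 i - p 0 i) * A i j - (x 0 j - p 0 j).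
have fE x j : f j x = (projv D (x - p) - (x - p)) 0 j.
  rewrite {1}(row_sum_delta (x - p)) linear_sum /f !mxE summxE; congr (_ - _).
  by apply: eq_bigr => i _; rewrite linearZ !mxE.
rewrite (_ : [set _ | _] = \bigcap_j (f j @^-1` [set 0])).
  apply: closed_bigI => j _; apply: closed_coord; first exact: closed_eq.
  apply: continuous_fun_sub; last exact: coord_sub_continuous.
  apply: continuous_sum => i; apply: continuous_fun_mul; last exact: cst_continuous.
  exact: coord_sub_continuous.
apply/seteqP; split=> x /=.
  by move=> /projv_id e j _; rewrite /preimage /= fE e subrr mxE.
move=> f0; suff -> : x - p = projv D (x - p) by exact: memv_proj.
apply/eqP; rewrite eq_sym -subr_eq0; apply/eqP/rowP => j.
by rewrite -fE mxE; exact: (f0 j).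
Qed.

Lemma souslin_borel (h : (nat -> bool) -> 'rV[R]_n) (X : set 'rV[R]_n) :
  (forall U, open U -> cyl_open (h @^-1` U)) ->
  measurable (X : set (borelRn R n)) -> souslin (h @^-1` X).
Proof.
move=> hU mX.
suff : (<<s opens R n >> `<=`
    [set B : set 'rV[R]_n | souslin (h @^-1` B) /\ souslin (h @^-1` ~` B)]).
  by move=> /(_ X mX) [].
have closedC U : open U -> souslin (h @^-1` ~` U).
  move=> oU; apply: souslin_closed => a aU Ua.
  have [k kU] := hU U oU a Ua; have [b bU e] := aU k.
  by apply: bU; apply: kU; rewrite /cyl /= size_mkseq.
apply: smallest_sub => [|U oU]; last by split; [exact/souslin_open/hU|exact: closedC].
split=> [|A [A1 A2]|A AP] /=.
- have := closedC _ (@openT _ : open (setT : set 'rV[R]_n)); rewrite setCT => s0.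
  by split=> //; rewrite setC0; apply: souslin_open; exact: (hU _ openT).
- by rewrite setTD setCK.
- split; first by rewrite preimage_bigcup; apply: souslin_bigcup => i; case: (AP i).
  rewrite setC_bigcup preimage_bigcap.
  by apply: souslin_bigcap => i; case: (AP i).
Qed.

Lemma frostman_borel (X : set 'rV[R]_n) (s : R) : (0 < n)%N -> 0 < s ->
  measurable (X : set (borelRn R n)) -> hausdorff_measure s X <> 0%E ->
  exists mu K, [/\ closed K, K `<=` X, frostman s mu, mu (~` K) = 0%E &
    (0 < mu [set: borelRn R n])%E].
Proof.
move=> n0 s0 mX /(hausdorff_measure_content n0 s0)[f].
set q := cube_rate n s; set h := cube_pt _ => cX.
have q0 : 0 < q by exact: cube_rate_gt0.
have hU U : open U -> cyl_open (h @^-1` U) by exact: cube_pt_open.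
have half : content q [::] (h @^-1` X) / 2 < content q [::] (h @^-1` X) by lra.
have [Y [YX clY cY]] := souslin_capacitable q0 (souslin_borel hU mX) half.
have T0 : 0 < content q [::] Y by apply: lt_le_trans cY; rewrite divr_gt0.
have [mu [muY muB]] := tree_measure q0 clY hU.
have muT : mu [set: borelRn R n] = (content q [::] Y)%:E by exact: muY.
have cK : closed (h @` Y).
  rewrite -openC openE => x nYx; apply: contrapT => nI.
  have /choice[a aP] k : exists a, Y a /\ forall j, `|x 0 j - h a 0 j| < (2 ^+ k)^-1.
    apply: contrapT => na; apply: nI; apply/nbhs_ballP.
    exists (2 ^+ k)^-1 => /=; first by rewrite invr_gt0 exprn_gt0.
    move=> y [_ xy] [a Ya ay]; apply: na; exists a; split=> // j.
    by rewrite ay; exact: xy.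
  have [|a' [y' a'P]] := @konig a (fun _ _ => 0%N) (fun=> 0%N) => //.
  have Ya' : Y a'.
    by apply: clY => k; have [l [_ e _]] := a'P k; exists (a l) => //; case: (aP l).
  apply: nYx; exists a' => //; apply/rowP => j.
  apply/eqP; rewrite eq_sym -subr_eq0 -normr_le0; apply/ler_addgt0Pl => e e0.
  have [k ke] := @pow2_small R (e / 2) ltac:(by rewrite divr_gt0).
  have [l [kl el _]] := a'P (n * k)%N.
  have := cube_pt_close (int_pt R f) j el; rewrite mulKn // -/h => c1.
  have [_ /(_ j) c2] := aP l.
  have c3 : (2 ^+ l)^-1 <= (2 ^+ k)^-1 :> R.
    rewrite lef_pV2 ?posrE ?exprn_gt0 // ler_weXn2l ?ler1n //.
    by apply: leq_trans kl; rewrite leq_pmull.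
  rewrite -(subrK (h (a l) 0 j) (x 0 j)) -addrA addr0.
  apply: le_trans (ler_normD _ _) _; apply: le_trans (lerD (ltW c2) c1) _.
  by lra.
exists mu, (h @` Y); split=> //.
- by move=> _ [a Ya <-]; exact: YX.
- exists (5 ^+ n * 2 `^ s); first by rewrite mulr_gt0 ?exprn_gt0 ?powR_gt0.
  move=> x r r0; have mB : measurable (eball x r : set (borelRn R n)).
    by apply: closed_borel; apply: eball_closed; exact: ltW.
  have [r1|r1] := leP r 1.
    have [ws [ws1 ws2 ws3]] := cube_pt_ball n0 s0 (int_pt R f) x r0 r1.
    apply: le_trans (muB _ ws mB ws3) _; rewrite lee_fin.
    apply: (@le_trans _ _ (\sum_(w <- ws) (2 `^ s * r `^ s))).
      by rewrite big_seq [leRHS]big_seq; apply: ler_sum.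
    rewrite big_const_seq count_predT iter_addr_0 -[leLHS]mulr_natl -mulrA.
    rewrite ler_wpM2r ?mulr_ge0 ?powR_ge0 // -natrX ler_nat.
    exact: ws1.
  apply: le_trans (_ : (mu [set: borelRn R n] <= _)%E).
    by apply: le_measure; rewrite ?inE.
  rewrite muT lee_fin; apply: le_trans (content_le_pow q0 _ _) _.
  rewrite expr0; have h1 : 1 <= 5 ^+ n :> R by rewrite exprn_ege1 // ler1n.
  have h2 t : 1 <= t -> 1 <= t `^ s.
    by move=> t1; rewrite -(powRr0 t) ler_powR // ltW.
  by rewrite !mulr_ege1 ?h2 ?ler1n // ltW.
- have : (mu (h @` Y) + mu (~` (h @` Y)) = mu [set: borelRn R n])%E.
    rewrite -measureU ?setUv ?setICr //; first exact: closed_borel.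
    by apply: measurableC; exact: closed_borel.
  have fin : mu (~` (h @` Y)) \is a fin_num.
    by apply: fin_num_measure; apply: measurableC; exact: closed_borel.
  rewrite muT muY // -(fineK fin) -EFinD => -[e].
  by congr (_%:E); lra.
- by rewrite muT lte_fin.
Qed.

End Borel.
(** * Irreducible pieces *)

Section Support.
Variables (R : realType) (n : nat).
Implicit Types (mu : {finite_measure set (borelRn R n) -> \bar R}).
Implicit Types (U K X : set 'rV[R]_n) (V : affine R n) (s : R).

Lemma nsuppP mu x : ~ supp mu x -> exists U, [/\ open U, U x & mu U = 0%E].
Proof.
move=> nx; apply: contrapT => nU; apply: nx => U oU Ux.
rewrite lt0e measure_ge0 andbT; apply/eqP => U0.
by apply: nU; exists U.
Qed.

Lemma supp_closed mu : closed (supp mu).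
Proof.
rewrite -openC openE => x /nsuppP[U [oU Ux U0]].
apply: (@filterS _ _ _ U); last exact: open_nbhs_nbhs.
by move=> y Uy /(_ U oU Uy); rewrite U0 ltxx.
Qed.

Lemma supp_sub_closed mu K : closed K -> mu (~` K) = 0%E -> supp mu `<=` K.
Proof.
move=> cK K0 x /(_ (~` K) (closed_openC cK)); rewrite K0 ltxx => h.
by apply: contrapT => /h.
Qed.

Lemma supp_null mu : (0 < n)%N -> mu (~` supp mu) = 0%E.
Proof.
move=> n0; have mS : measurable (~` supp mu : set (borelRn R n)).
  by apply: measurableC; apply: closed_borel; exact: supp_closed.
pose I := ({ffun 'I_n -> int} * seq bool)%type.
pose img (x : I) := cube_pt (int_pt R x.1) @` cyl x.2.
have /choice[N NP] (x : I) : exists U : set 'rV[R]_n, [/\ open U, mu U = 0%E &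
    (exists U', [/\ open U', mu U' = 0%E & img x `<=` U']) -> img x `<=` U].
  have [[U' [oU U0 xU]]|nU] := pselect
      (exists U', [/\ open U', mu U' = 0%E & img x `<=` U']).
    by exists U'.
  by exists set0; split.
pose M i : set (borelRn R n) := if pickle_inv i is Some x then N x else set0.
apply/measure_negligible => //.
apply: (@negligibleS _ _ _ mu (\bigcup_i M i)).
  move=> x /nsuppP[U [oU Ux U0]].
  pose f := [ffun j => Num.floor (x 0 j)] : {ffun 'I_n -> int}.
  have [a ax] : exists a, cube_pt (int_pt R f) a = x.
    apply: cube_pt_surj => // j; rewrite mxE ffunE.
    by rewrite Num.Theory.floor_le /= -intrD1 ltW // floorD1_gt.
  have Ua : (cube_pt (int_pt R f) @^-1` U) a by rewrite /preimage /= ax.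
  have [k kU] := cube_pt_open n0 oU Ua.
  exists (pickle (f, mkseq a k)) => //; rewrite /M pickleK_inv.
  case: (NP (f, mkseq a k)) => _ _; apply.
    by exists U; split=> // _ [b kb <-]; exact: kU.
  by exists a => //; exact: cyl_mkseq.
apply: negligible_bigcup => i; rewrite /M; case: pickle_inv => [x|].
  by case: (NP x) => oN N0 _; apply/negligibleP => //; exact: open_borel.
exact: negligible_set0.
Qed.

Lemma restriction mu (D : set 'rV[R]_n) : measurable (D : set (borelRn R n)) ->
  exists nu : {finite_measure set (borelRn R n) -> \bar R},
    forall A, nu A = mu (A `&` D).
Proof.
move=> mD; have foo : (mu D < +oo)%E by rewrite ltey_eq fin_num_measure.
by exists (mfrestr mD foo).
Qed.

Lemma frostman_restriction mu (nu : {finite_measure set (borelRn R n) -> \bar R})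
    (D : set 'rV[R]_n) s : measurable (D : set (borelRn R n)) ->
  (forall A, nu A = mu (A `&` D)) -> frostman s mu -> frostman s nu.
Proof.
move=> mD nuE [C C0 muC]; exists C => // x r r0.
have mB : measurable (eball x r : set (borelRn R n)).
  by apply: closed_borel; apply: eball_closed; exact: ltW.
apply: le_trans (muC x r r0); rewrite nuE.
by apply: le_measure; rewrite ?inE //; exact: measurableI.
Qed.

Lemma frostman_point mu s x : 0 < s -> frostman s mu -> mu [set x] = 0%E.
Proof.
move=> s0 [C C0 muC]; apply/eqP; rewrite eq_le measure_ge0 andbT.
have xE : [set x] = aset (Affine x 0%VS).
  apply/seteqP; split=> y /=; rewrite /aset /= memv0 subr_eq0.
    by move=> ->.
  by move/eqP.
have mx : measurable ([set x] : set (borelRn R n)).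
  by rewrite xE; apply: closed_borel; exact: aset_closed.
apply/lee_addgt0Pr => e e0; rewrite add0e.
pose r := (e / C) `^ s^-1.
have r0 : 0 < r by rewrite powR_gt0 // divr_gt0.
apply: (@le_trans _ _ (mu (eball x r))).
  apply: le_measure; rewrite ?inE //.
    by apply: closed_borel; apply: eball_closed; exact: ltW.
  move=> _ ->; rewrite /eball /= /Defs.edist big1 ?sqrtr0 ?ltW // => i _.
  by rewrite subrr expr0n.
apply: le_trans (muC x r r0) _; rewrite lee_fin /r -powRrM mulVf ?gt_eqF //.
by rewrite powRr1 ?(ltW (divr_gt0 _ _)) // mulrC divfK // lt0r_neq0.
Qed.

End Support.

Section AffineSubspaces.
Variables (R : realType) (n : nat).
Implicit Types (A B V : affine R n).

Lemma aset_point A : aset A (apoint A).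
Proof. by rewrite /aset /= subrr mem0v. Qed.

Lemma aset_add A x v : aset A x -> v \in adir A -> aset A (x + v).
Proof. by rewrite /aset /= => Ax Av; rewrite addrAC memvD. Qed.

Lemma aset_diff A x y : aset A x -> aset A y -> x - y \in adir A.
Proof.
rewrite /aset /= => Ax Ay; have := memvB Ax Ay.
by rewrite opprB addrA subrK.
Qed.

Lemma adir_sub A B : aset A `<=` aset B -> (adir A <= adir B)%VS.
Proof.
move=> AB; apply/subvP => v Av.
have := aset_diff (AB _ (aset_add (aset_point A) Av)) (AB _ (aset_point A)).
by rewrite addrAC subrr add0r.
Qed.

Lemma aset_sub A B :
  aset B (apoint A) -> (adir A <= adir B)%VS -> aset A `<=` aset B.
Proof.
move=> BA /subvP sAB x; rewrite {1}/aset /= => /sAB xA.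
by have := aset_add BA xA; rewrite addrC subrK.
Qed.

Lemma adim_mono A B : aset A `<=` aset B -> (adim A <= adim B)%N.
Proof. by move=> /adir_sub; exact: dimvS. Qed.

Lemma adim_proper A B : aset A `<=` aset B -> ~ aset B `<=` aset A ->
  (adim A < adim B)%N.
Proof.
move=> AB nBA; rewrite ltn_neqAle adim_mono // andbT; apply/eqP => e.
apply: nBA; have /eqP dE : adir A == adir B.
  by rewrite eqEdim adir_sub //= -/(adim A) -/(adim B) e.
apply: aset_sub; last by rewrite dE.
rewrite /aset /= dE; apply: aset_diff; first exact: aset_point.
exact: AB (aset_point A).
Qed.

Definition ajoin A B : affine R n :=
  Affine (apoint A) (adir A + adir B + <[apoint B - apoint A]>).

Lemma ajoin_l A B : aset A `<=` aset (ajoin A B).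
Proof.
apply: aset_sub; first exact: aset_point.
by rewrite /= -addvA addvSl.
Qed.

Lemma ajoin_r A B : aset B `<=` aset (ajoin A B).
Proof.
apply: aset_sub; last by rewrite /= (addvC (adir A)) -addvA addvSl.
by rewrite /aset /=; apply: (subvP (addvSr _ _)); exact: memv_line.
Qed.

Lemma ajoin_sub A B V : aset A `<=` aset V -> aset B `<=` aset V ->
  aset (ajoin A B) `<=` aset V.
Proof.
move=> AV BV; apply: aset_sub; first by apply: AV; exact: aset_point.
rewrite /= !subv_add !adir_sub //= -memvE.
by apply: aset_diff; [apply: BV|apply: AV]; exact: aset_point.
Qed.

Lemma aset_setI A B x : aset A x -> aset B x ->
  aset A `&` aset B = aset (Affine x (adir A :&: adir B)%VS).
Proof.
move=> Ax Bx; apply/seteqP; split=> y.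
  by move=> [Ay By]; rewrite /aset /= memv_cap !aset_diff.
rewrite {1}/aset /= memv_cap => /andP[Ay By]; rewrite -(subrK x y) addrC.
by split; exact: aset_add.
Qed.

End AffineSubspaces.
Section IrreducibleMeasures.
Variables (R : realType) (n : nat) (n_gt0 : (0 < n)%N).
Variables (s : R) (s_gt0 : 0 < s).
Implicit Types (mu nu : {finite_measure set (borelRn R n) -> \bar R}).
Implicit Types (X K : set 'rV[R]_n) (V : affine R n).

Lemma measurable_aset V : measurable (aset V : set (borelRn R n)).
Proof. by apply: closed_borel; exact: aset_closed. Qed.

Lemma measure_supp mu (A : set 'rV[R]_n) : measurable (A : set (borelRn R n)) ->
  supp mu `<=` A -> mu A = mu [set: borelRn R n].
Proof.
move=> mA suppA; have mAc : measurable (~` A : set (borelRn R n)) by exact: measurableC.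
have A0 : mu (~` A) = 0%E.
  apply/eqP; rewrite -measure_le0 -(supp_null mu n_gt0).
  apply: le_measure; rewrite ?inE //; last exact: subsetC.
  by apply: measurableC; apply: closed_borel; exact: supp_closed.
have : (mu A + mu (~` A) = mu [set: borelRn R n])%E.
  by rewrite -measureU ?setUv ?setICr.
by rewrite A0 adde0.
Qed.

Definition frostman_piece X V mu : Prop :=
  [/\ frostman s mu, irreducible_in mu V, supp mu `<=` X `&` aset V &
      (0 < mu [set: borelRn R n])%E].

(* Among the affine subspaces of positive measure, take one of minimal
   dimension. *)
Lemma frostman_piece_exists mu K X : closed K -> K `<=` X -> frostman s mu ->
  mu (~` K) = 0%E -> (0 < mu [set: borelRn R n])%E ->
  exists V nu, frostman_piece X V nu /\ exists2 x, K x & aset V x.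
Proof.
move=> cK KX fmu K0 muT.
have ex : exists d, `[< exists V, adim V = d /\ (0 < mu (aset V))%E >].
  exists (adim (Affine (0 : 'rV[R]_n) fullv)); apply/asboolP.
  exists (Affine 0 fullv); split=> //; rewrite (_ : aset _ = setT) //.
  by apply/seteqP; split=> // x _; rewrite /aset /= memvf.
case: (ex_minnP ex) => d /asboolP[V [dV V0]] dmin.
have [nu nuE] := restriction mu (measurable_aset V).
have mKc : measurable (~` K : set (borelRn R n)).
  by apply: measurableC; exact: closed_borel.
exists V, nu; split; first split.
- exact: frostman_restriction (measurable_aset V) nuE fmu.
- split.
    apply: supp_sub_closed; first exact: aset_closed.
    by rewrite nuE setICl measure0.
  move=> V' V'V; apply/eqP; rewrite nuE eq_le measure_ge0 andbT leNgt.
  apply/negP => pos; have [V'sub nVV'] := V'V.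
  have : (adim V' < adim V)%N by apply: adim_proper => // /nVV'.
  rewrite dV ltnNge dmin //; apply/asboolP; exists V'; split=> //.
  by move: pos; rewrite setIidl.
- move=> x xs; split.
    apply: KX; apply: supp_sub_closed x xs => //.
    apply/eqP; rewrite nuE eq_le measure_ge0 andbT -K0.
    apply: le_measure; rewrite ?inE //.
    by apply: measurableI => //; exact: measurable_aset.
  apply: supp_sub_closed x xs; first exact: aset_closed.
  by rewrite nuE setICl measure0.
- by rewrite nuE setTI.
- apply: contrapT => nx; move: V0; rewrite ltNge => /negP; apply.
  rewrite -K0; apply: le_measure; rewrite ?inE //; first exact: measurable_aset.
  by move=> x Vx Kx; apply: nx; exists x.
Qed.

Lemma frostman_piece_dim X V mu : frostman_piece X V mu -> (0 < adim V)%N.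
Proof.
move=> [fmu _ sX muT]; rewrite lt0n; apply/negP => /eqP d0.
have V1 : aset V = [set apoint V].
  have {}d0 : adir V = 0%VS by apply/eqP; rewrite -dimv_eq0 -/(adim V) d0.
  apply/seteqP; split=> x /=; rewrite /aset /= d0 memv0 subr_eq0; first by move/eqP.
  by move=> ->.
move: muT; rewrite -(measure_supp (measurable_aset V)); last by move=> x /sX[].
by rewrite V1 (frostman_point _ s_gt0 fmu) ltxx.
Qed.

Lemma frostman_piece_cover X V mu r (G : 'I_r -> affine R n) :
  frostman_piece X V mu -> aset V `<=` \bigcup_j aset (G j) ->
  exists j, aset V `<=` aset (G j).
Proof.
move=> [fmu [_ irr] sX muT] VG; apply: contrapT => nj.
pose VGj j : set (borelRn R n) := aset V `&` aset (G j).
have mVG j : measurable (VGj j) by apply: measurableI; exact: measurable_aset.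
have VG0 j : mu (VGj j) = 0%E.
  have [[x [Vx Gx]]|empty] := pselect (exists x, aset V x /\ aset (G j) x); last first.
    rewrite /VGj (_ : _ `&` _ = set0) ?measure0 //.
    by apply/seteqP; split=> // x [Vx Gx]; apply: empty; exists x.
  rewrite /VGj (aset_setI Vx Gx); apply: irr; rewrite -(aset_setI Vx Gx).
  split; first exact: subIsetl.
  by move=> VsG; apply: nj; exists j => y /VsG[].
move: muT; rewrite -(measure_supp (measurable_aset V)); last by move=> x /sX[].
rewrite ltNge => /negP; apply.
apply: (@le_trans _ _ (mu (\big[setU/set0]_(j <- index_enum 'I_r) VGj j))).
  apply: le_measure; rewrite ?inE; first exact: measurable_aset.
    exact: bigsetU_measurable.
  move=> x Vx; have [j _ Gx] := VG x Vx; rewrite -bigcup_seq.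
  by exists j => //=; rewrite mem_index_enum.
by apply: le_trans (measure_bigsetU_le _ _ mVG) _; rewrite big1 // => j _; exact: VG0.
Qed.

Lemma frostman_piece_restriction X V mu nu (D : set 'rV[R]_n) : closed D ->
  (forall A, nu A = mu (A `&` D)) -> (0 < mu D)%E ->
  frostman_piece X V mu -> frostman_piece X V nu /\ supp nu `<=` D.
Proof.
move=> cD nuE D0 [fmu [Vmu irr] sX _]; have mD := closed_borel cD.
have nu_mu (A : set 'rV[R]_n) : measurable (A : set (borelRn R n)) -> (nu A <= mu A)%E.
  move=> mA; rewrite nuE; apply: le_measure; rewrite ?inE //.
  exact: measurableI.
have sub : supp nu `<=` supp mu.
  move=> x xs U oU Ux; apply: lt_le_trans (xs U oU Ux) _.
  by apply: nu_mu; exact: open_borel.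
split; last by apply: supp_sub_closed => //; rewrite nuE setICl measure0.
split; [exact: frostman_restriction mD nuE fmu|split|by move=> x /sub /sX|
  by rewrite nuE setTI].
  by move=> x /sub /Vmu.
move=> V' /irr V'0; apply/eqP; rewrite -measure_le0 -V'0.
by apply: nu_mu; exact: measurable_aset.
Qed.

Lemma supp_avoid X V mu (p : seq 'rV[R]_n) : frostman_piece X V mu ->
  exists2 x, supp mu x & x \notin p.
Proof.
move=> [fmu _ _ muT]; apply: contrapT => nx.
have mx (x : 'rV[R]_n) : measurable ([set x] : set (borelRn R n)).
  have -> : [set x] = aset (Affine x 0%VS).
    apply/seteqP; split=> y /=; rewrite /aset /= memv0 subr_eq0; last by move/eqP.
    by move=> ->.
  exact: measurable_aset.
move: muT; rewrite -(measure_supp (A := supp mu)) //; last first.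
  by apply: closed_borel; exact: supp_closed.
rewrite ltNge => /negP; apply.
apply: (@le_trans _ _ (mu (\big[setU/set0]_(x <- p) ([set x] : set (borelRn R n))))).
  apply: le_measure; rewrite ?inE.
  - by apply: closed_borel; exact: supp_closed.
  - by apply: bigsetU_measurable => x _; exact: mx.
  move=> x xs; rewrite -bigcup_seq; exists x => //=.
  by apply/negPn/negP => xp; apply: nx; exists x.
apply: le_trans (measure_bigsetU_le _ _ mx) _; rewrite big1 // => x _.
exact: frostman_point s_gt0 fmu.
Qed.

End IrreducibleMeasures.

Section DisjointSupports.
Variables (R : realType) (n : nat) (n_gt0 : (0 < n)%N).
Variables (s : R) (s_gt0 : 0 < s).

Lemma dist_continuous (p : 'rV[R]_n) : continuous (fun y : 'rV[R]_n => `|p - y|).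
Proof.
have gen (W : normedModType R) (x : W) : continuous (fun y : W => `|x - y|).
  by move=> y; apply: cvg_norm; apply: cvgB; [exact: cvg_cst|exact: cvg_id].
exact: gen.
Qed.

Lemma pos_lower_bound (T : eqType) (r : seq T) (f : T -> R) :
  (forall x, x \in r -> 0 < f x) -> exists2 e, 0 < e & forall x, x \in r -> e <= f x.
Proof.
elim: r => [|y r IH] fr; first by exists 1.
have [|e e0 er] := IH; first by move=> x xr; apply: fr; rewrite inE xr orbT.
exists (Num.min e (f y)); first by rewrite lt_min e0 fr ?mem_head.
by move=> x; rewrite inE => /predU1P[->|/er]; rewrite ge_min ?lexx ?orbT // => ->.
Qed.

Lemma disjoint_pieces (X : set 'rV[R]_n) (V : nat -> affine R n)
    (mu : nat -> {finite_measure set (borelRn R n) -> \bar R}) (m : nat) :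
  (forall k, frostman_piece s X (V k) (mu k)) ->
  exists nu : nat -> {finite_measure set (borelRn R n) -> \bar R},
    (forall k, (k < m)%N -> frostman_piece s X (V k) (nu k)) /\
    (forall i j, (i < m)%N -> (j < m)%N -> i != j ->
       supp (nu i) `&` supp (nu j) = set0).
Proof.
move=> muP.
have [||z zP] := @mkseq_chain _ (fun p : seq 'rV[R]_n => uniq p /\
    forall i, (i < size p)%N -> supp (mu i) (nth 0 p i)).
- by [].
- move=> p [up pP]; have [x xs xp] := supp_avoid n_gt0 s_gt0 p (muP (size p)).
  exists x; rewrite rcons_uniq xp up; split=> // i; rewrite size_rcons ltnS nth_rcons.
  by rewrite leq_eqVlt => /predU1P[->|ip]; [rewrite ltnn eqxx|rewrite ip; exact: pP].
have [uz zs] := zP m; rewrite size_mkseq in zs.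
pose pairs := [seq p <- [seq (i, j) | i <- iota 0 m, j <- iota 0 m] | p.1 != p.2].
have [|e e0 eP] := @pos_lower_bound _ pairs (fun p => `|z p.1 - z p.2| / 3).
  move=> [i j]; rewrite mem_filter /= => /andP[ij /allpairsP[[i' j'] /= [im jm [? ?]]]].
  subst i' j'; rewrite !mem_iota !add0n /= in im jm.
  rewrite divr_gt0 // normr_gt0 subr_eq0; apply/negP => /eqP zij.
  move/(nth_uniq 0): uz => /(_ i j); rewrite size_mkseq !nth_mkseq // zij eqxx.
  by rewrite (negbTE ij) => /(_ im jm).
pose D k : set 'rV[R]_n := [set y | `|z k - y| <= e].
have cD k : closed (D k).
  apply: (@closed_coord R n (fun y => `|z k - y|) [set t | t <= e]).
    exact: closed_le.
  exact: dist_continuous.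
have /choice[nu nuE] k := restriction (mu k) (closed_borel (cD k)).
have D0 k : (k < m)%N -> (0 < mu k (D k))%E.
  move=> km; have oU : open [set y : 'rV[R]_n | `|z k - y| < e].
    apply: (@open_comp _ _ (fun y : 'rV[R]_n => `|z k - y|) [set t | t < e]).
      by move=> x _; exact: dist_continuous.
    exact: open_lt.
  have zU : `|z k - z k| < e by rewrite subrr normr0.
  have := zs k km; rewrite nth_mkseq // => /(_ _ oU zU) /lt_le_trans; apply.
  apply: le_measure; rewrite ?inE; [exact: open_borel|exact: closed_borel|].
  by move=> y /= /ltW.
exists nu; split=> [k km|i j im jm ij].
  by case: (frostman_piece_restriction (cD k) (nuE k) (D0 k km) (muP k)).
have [_ si] := frostman_piece_restriction (cD i) (nuE i) (D0 i im) (muP i).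
have [_ sj] := frostman_piece_restriction (cD j) (nuE j) (D0 j jm) (muP j).
apply/seteqP; split=> // y [/si yi /sj yj].
have := eP (i, j); rewrite mem_filter ij /= allpairs_f ?mem_iota // => /(_ erefl).
have := ler_normD (z i - y) (y - z j); rewrite addrA subrK.
move: yi yj; rewrite /D /= [`|y - z j|]distrC => ? ? ?.
by lra.
Qed.

End DisjointSupports.

(** * Covering families of affine subspaces *)

Section CoveringFamilies.
Variables (R : realType) (n : nat) (P : affine R n -> Prop).
Hypothesis P_dim : forall V, P V -> (0 < adim V)%N.
Hypothesis P_cover : forall V r (G : 'I_r -> affine R n), P V ->
  aset V `<=` \bigcup_j aset (G j) -> exists j, aset V `<=` aset (G j).
Hypothesis P_avoid : forall m (F : 'I_m -> affine R n),
  (\sum_i adim (F i) < n)%N ->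
  exists2 V, P V & forall i, ~ aset V `<=` aset (F i).

Definition refines m r (F : 'I_m -> affine R n) (G : 'I_r -> affine R n) :=
  exists2 sigma : 'I_m -> 'I_r, injective sigma &
    forall i, aset (F i) `<=` aset (G (sigma i)).

Lemma refines_dim m r (F : 'I_m -> affine R n) (G : 'I_r -> affine R n) :
  refines F G -> (\sum_i adim (F i) <= \sum_j adim (G j))%N.
Proof.
move=> [sigma inj FG].
apply: (@leq_trans (\sum_i adim (G (sigma i)))).
  by apply: leq_sum => i _; exact: adim_mono.
have -> : (\sum_i adim (G (sigma i)) = \sum_(j in [set sigma i | i : 'I_m]%SET) adim (G j))%N.
  by rewrite big_imset //= => i j _ _; exact: inj.
by rewrite [leqRHS](bigID (mem [set sigma i | i : 'I_m]%SET)) /= leq_addr.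
Qed.

Definition join_at m (F : 'I_m -> affine R n) V i j :=
  if j == i then ajoin (F i) V else F j.

Definition add_block m (F : 'I_m -> affine R n) V (j : 'I_m.+1) :=
  if unlift ord0 j is Some i then F i else V.

Lemma refines_join_at m r (F : 'I_m -> affine R n) (G : 'I_r -> affine R n) V
    (sigma : 'I_m -> 'I_r) i : injective sigma ->
  (forall i, aset (F i) `<=` aset (G (sigma i))) ->
  aset V `<=` aset (G (sigma i)) -> refines (join_at F V i) G.
Proof.
move=> inj FG VG; exists sigma => // j; rewrite /join_at; case: eqP => [->|_] //.
exact: ajoin_sub.
Qed.

Lemma refines_add_block m r (F : 'I_m -> affine R n) (G : 'I_r -> affine R n) V
    (sigma : 'I_m -> 'I_r) k : injective sigma ->
  (forall i, aset (F i) `<=` aset (G (sigma i))) ->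
  (forall i, sigma i != k) ->
  aset V `<=` aset (G k) -> refines (add_block F V) G.
Proof.
move=> inj FG nk VG.
exists (fun j => if unlift ord0 j is Some i then sigma i else k).
  move=> j j'; case: unliftP => [i ->|->]; case: unliftP => [i' ->|->] //.
  - by move/inj ->.
  - by move=> e; move: (nk i); rewrite e eqxx.
  - by move=> e; move: (nk i'); rewrite -e eqxx.
by move=> j; rewrite /add_block; case: unliftP.
Qed.

(* Each V outside the subspaces of F forces a covering refined by F to be
   refined by one of finitely many families of larger total dimension. *)
Lemma covering_family k m (F : 'I_m -> affine R n) :
  (n <= \sum_i adim (F i) + k)%N ->
  exists L : seq (affine R n), (forall V, List.In V L -> P V) /\
    forall r (G : 'I_r -> affine R n), refines F G ->
      (forall V, List.In V L -> aset V `<=` \bigcup_j aset (G j)) ->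
      (n <= \sum_j adim (G j))%N.
Proof.
elim: k m F => [|k IH] m F.
  rewrite addn0 => nF; exists [::]; split=> // r G /refines_dim FG _.
  exact: leq_trans FG.
move=> nF; have [nF'|Fn] := leqP n (\sum_i adim (F i)).
  by exists [::]; split=> // r G /refines_dim FG _; exact: leq_trans FG.
have [V PV VF] := P_avoid Fn.
have /choice[Lj LjP] i : exists L : seq (affine R n), (forall V, List.In V L -> P V) /\
    forall r (G : 'I_r -> affine R n), refines (join_at F V i) G ->
      (forall V, List.In V L -> aset V `<=` \bigcup_j aset (G j)) ->
      (n <= \sum_j adim (G j))%N.
  apply: IH; apply: leq_trans nF _; rewrite addnS -addSn leq_add2r.
  rewrite (bigD1 i) //= [ltnRHS](bigD1 i) //= -addSn; apply: leq_add.
    rewrite /join_at eqxx; apply: adim_proper; first exact: ajoin_l.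
    by move=> sub; apply: (VF i) => x Vx; apply: sub; exact: ajoin_r.
  by apply: leq_sum => j /negbTE ji; rewrite /join_at ji.
have [La [LaP LaG]] : exists L : seq (affine R n), (forall V, List.In V L -> P V) /\
    forall r (G : 'I_r -> affine R n), refines (add_block F V) G ->
      (forall V, List.In V L -> aset V `<=` \bigcup_j aset (G j)) ->
      (n <= \sum_j adim (G j))%N.
  apply: IH; apply: leq_trans nF _; rewrite addnS -addSn leq_add2r big_ord_recl.
  rewrite {1}/add_block unlift_none -add1n; apply: leq_add; first exact: P_dim.
  by apply: leq_sum => i _; rewrite /add_block liftK.
pose Lf := flatten [seq Lj i | i <- enum 'I_m].
have LfP W : List.In W Lf <-> exists i, List.In W (Lj i).
  rewrite /Lf; split.
    elim: (enum 'I_m) => //= i e IHe /List.in_app_iff[Wi|/IHe //].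
    by exists i.
  move=> [i Wi]; have : i \in enum 'I_m by rewrite mem_enum.
  elim: (enum 'I_m) => //= j e IHe; rewrite inE => /predU1P[<-|ie].
    by apply/List.in_app_iff; left.
  by apply/List.in_app_iff; right; exact: IHe.
exists (V :: La ++ Lf); split=> [W /= [<-//|]|r G [sigma inj FG] cov].
  by move=> /List.in_app_iff[/LaP //|/LfP[i]]; case: (LjP i) => + _; apply.
have [j VGj] := P_cover PV (cov V (or_introl erefl)).
have [[i si]|ns] := pselect (exists i, sigma i = j).
  have [_ +] := LjP i; apply; first by apply: refines_join_at inj FG _; rewrite si.
  move=> W Wi; apply: cov; right; apply/List.in_app_iff; right.
  by apply/LfP; exists i.
apply: LaG; first apply: refines_add_block inj FG _ VGj.
  by move=> i; apply/negP => /eqP si; apply: ns; exists i.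
by move=> W Wa; apply: cov; right; apply/List.in_app_iff; left.
Qed.

End CoveringFamilies.
Theorem lemma1p7 (R : realType) (n : nat) (hn : (2 <= n)%N)
    (X : set 'rV[R]_n)
    (hX : measurable (X : set (borelRn R n)))
    (hNC : non_concentrated X)
    (hdim : (0 < hausdorff_dim X)%E)
    (s : R) (hs0 : 0 < s) (hs : (s%:E < hausdorff_dim X)%E) :
  exists (m : nat) (V : 'I_m -> affine R n)
         (mu : 'I_m -> {finite_measure set (borelRn R n) -> \bar R}),
    [/\ (1 <= m)%N,
        forall i, frostman s (mu i) /\
                  supported_on (mu i) (X `&` aset (V i)),
        forall i, irreducible_in (mu i) (V i) /\ (0 < mu i X)%E,
        forall i j, i != j -> supp (mu i) `&` supp (mu j) = set0
      & forall (r : nat) (F : 'I_r -> affine R n), (1 <= r)%N ->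
          \bigcup_i aset (V i) `<=` \bigcup_j aset (F j) ->
          (n <= \sum_(j < r) adim (F j))%N].
Proof.

have n0 : (0 < n)%N by apply: ltn_trans hn.
pose P V := exists mu, frostman_piece s X V mu.
have P_dim V : P V -> (0 < adim V)%N.
  by move=> [mu]; exact: frostman_piece_dim.
have P_cover V r (G : 'I_r -> affine R n) : P V ->
    aset V `<=` \bigcup_j aset (G j) -> exists j, aset V `<=` aset (G j).
  by move=> [mu pV]; exact: (frostman_piece_cover n0 pV).
have P_avoid m (F : 'I_m -> affine R n) : (\sum_i adim (F i) < n)%N ->
    exists2 V, P V & forall i, ~ aset V `<=` aset (F i).
  move=> Fn; pose Z := X `\` \bigcup_i aset (F i).
  have mZ : measurable (Z : set (borelRn R n)).
    apply: measurableD => //; apply: countable_bigcupT_measurable.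
      exact: countableP.
    by move=> i; exact: measurable_aset.
  have dZ : hausdorff_dim Z = hausdorff_dim X.
    case: m F Fn @Z mZ => [|m] F Fn Z mZ; last first.
      by apply: hNC; rewrite // subn1 -ltnS prednK.
    congr hausdorff_dim; apply/seteqP; split=> [x []//|x Xx].
    by split=> // -[[]].
  have hZ : hausdorff_measure s Z <> 0%E.
    move=> Z0; move: hs; rewrite -dZ ltNge => /negP; apply.
    by apply: ereal_inf_lbound; exists s => //; split=> //; exact: ltW.
  have [mu [K [cK KZ fmu K0 muT]]] := frostman_borel n0 hs0 mZ hZ.
  have KX : K `<=` X by move=> x /KZ[].
  have [V [nu [pV [x Kx Vx]]]] := frostman_piece_exists cK KX fmu K0 muT.
  exists V; first by exists nu.
  by move=> i VF; have [_] := KZ x Kx; apply; exists i => //; exact: VF.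
have [L [LP LG]] := covering_family P_dim P_cover P_avoid
  (F := fun i : 'I_0 => Affine 0 0%VS) (leq_addl _ n).
have ref0 r (G : 'I_r -> affine R n) :
    refines (fun i : 'I_0 => Affine 0 0%VS : affine R n) G.
  by exists (fun i : 'I_0 => match i with Ordinal _ h => False_rect _ (notF h) end) => -[].
case: L => [|V0 L'] in LP LG *.
  have := LG 1%N (fun=> Affine 0 0%VS) (ref0 _ _) (fun V (h : List.In V [::]) => False_ind _ h).
  by rewrite big_ord1 /adim /= dimv0 leqNgt n0.
set L := V0 :: L' in LP LG.
have inL k : List.In (nth V0 L k) L.
  have [kL|Lk] := ltnP k (size L); last by rewrite nth_default //; left.
  elim: L k kL {LP LG} => //= W e IH [|k] kL; first by left.
  by right; exact: IH.
have /choice[mu muP] k : P (nth V0 L k) by exact: LP.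
have [nu [nuP nuD]] := disjoint_pieces n0 hs0 (size L) muP.
exists (size L), (fun i => nth V0 L i), (fun i => nu i); split=> //.
- by move=> i; case: (nuP i (ltn_ord i)).
- move=> i; have [_ irr sX nuT] := nuP i (ltn_ord i); split=> //.
  by rewrite measure_supp // => x /sX[].
- by move=> i j ij; apply: nuD.
- move=> r F r1 cov; apply: LG => // V VL.
  have [k kL <-] : exists2 k, (k < size L)%N & nth V0 L k = V.
    elim: L VL {LP inL muP nu nuP nuD cov mu} => //= W e IH [<-|/IH[k ke <-]].
      by exists 0%N.
    by exists k.+1.
  by move=> x Vx; apply: cov; exists (Ordinal kL).
Qed.
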